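(* Let $\lambda$ be a security parameter. Suppose there exists an algorithm $\mathcal{T}=(\mathcal{T}_1,\mathcal{T}_2)$ that is a weakly-efficient shadow tomography procedure for all mixed quantum states, with number of copies $k=k(n,\log M,1/\varepsilon,\log(1/\delta))$ for polynomial $k$. Then there does not exist a $k$-copy everlasting secure untelegraphable encryption scheme that also satisfies correctness.
   Context: QPT means quantum polynomial time; $\mathrm{negl}$ denotes a negligible function. Weakly-efficient shadow tomography (WEST). Let $E$ denote a uniform quantum circuit family with classical binary output that takes as input $i\in[M]$ and an $n$-qubit quantum state $\rho$. A shadow tomography procedure here is a pair of algorithms $(\mathcal{T}_1,\mathcal{T}_2)$ where $\mathcal{T}_1$ takes as input $E$ and $k$ copies of $\rho$, and outputs a classical string $\mathsf{st}$ such that, for $i\in[M]$, $\Pr[|\mathcal{T}_2(i,\mathsf{st})-\Pr[E(i,\rho)=1]|\le\varepsilon]\ge1-\delta$. The procedure is weakly-efficient if the number of copies $k$ and the runtime of $\mathcal{T}_1$ are both $\mathrm{poly}(n,\log M,1/\varepsilon,\log 1/\delta)$; $\mathcal{T}_2$ can run in unbounded time. Untelegraphable encryption (UTE). A tuple of QPT algorithms $(\mathsf{Gen},\mathsf{Enc},\mathsf{Dec})$: $\mathsf{Gen}(1^\lambda)$ outputs classical encryption and decryption keys $(\mathsf{ek},\mathsf{dk})$ (possibly equal, $\mathsf{ek}=\mathsf{dk}=\mathsf{sk}$); $\mathsf{Enc}(\mathsf{ek},m)$ outputs a quantum ciphertext; $\mathsf{Dec}(\mathsf{dk},\cdot)$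 takes a quantum ciphertext and outputs a message. Correctness: for every $\lambda$ and every message $m$, $\Pr[\mathsf{Dec}(\mathsf{dk},\mathsf{Enc}(\mathsf{ek},m))=m]\ge1-\mathrm{negl}(\lambda)$, where $(\mathsf{ek},\mathsf{dk})\leftarrow\mathsf{Gen}(1^\lambda)$. $t$-copy everlasting security. For a bit $b$ and a two-stage adversary $(\mathcal{A},\mathcal{B})$: $\mathcal{A}$ specifies a single pair of messages $(m_0,m_1)$ and gets $t$ encryptions of $m_b$ (under the same key) in return; $\mathcal{A}$ outputs a classical string $\mathsf{st}$; $\mathcal{B}$ receives $\mathsf{st}$ and the decryption key $\mathsf{dk}$ and outputs a bit $b_{\mathcal{B}}$. The scheme is $t$-copy everlasting secure if $|\Pr[b_{\mathcal{B}}=1\mid b=0]-\Pr[b_{\mathcal{B}}=1\mid b=1]|=\mathrm{negl}(\lambda)$ for all $(\mathcal{A},\mathcal{B})$ where $\mathcal{A}$ is QPT and $\mathcal{B}$ is allowed to run in unbounded time. *)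

(* Defs.v *)
From mathcomp Require Import all_boot all_order all_algebra.
From mathcomp Require Import all_classical all_reals all_analysis.
From mathcomp Require Import complex.

Set Implicit Arguments.
Unset Strict Implicit.
Unset Printing Implicit Defensive.

Import Order.TTheory GRing.Theory Num.Theory.

Local Open Scope ring_scope.

(* The machine has finitely many stacks of bits (a
   Turing machine tape is two stacks) and structured control; each instruction
   and each test costs one step, so that time agrees with multi-tape Turing
   machine time up to a constant factor. *)

Definition memory := nat -> seq bool.

Definition upd (m : memory) (x : nat) (s : seq bool) : memory :=
  fun y => if y == x then s else m y.

Inductive program :=
| Skip
| Push of bool & nat
| Pop of nat
| Seq of program & program
| Case of nat & program & program & program (* stack empty / top 0 / top 1 *)
| While of nat & program.                   (* loop while stack is nonempty *)

Inductive exec : program -> memory -> memory -> nat -> Prop :=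
| ExSkip m : exec Skip m m 1
| ExPush b x m : exec (Push b x) m (upd m x (b :: m x)) 1
| ExPop x m : exec (Pop x) m (upd m x (behead (m x))) 1
| ExSeq p q m m' m'' t t' :
    exec p m m' t -> exec q m' m'' t' -> exec (Seq p q) m m'' (t + t')
| ExCase x p q r m m' t :
    exec (match m x with
          | [::] => p
          | false :: _ => q
          | true :: _ => r
          end) m m' t ->
    exec (Case x p q r) m m' t.+1
| ExWhileNil x p m : m x = [::] -> exec (While x p) m m 1
| ExWhileCons x p m m' m'' t t' :
    m x <> [::] -> exec p m m' t -> exec (While x p) m' m'' t' ->
    exec (While x p) m m'' (t + t').+1.

(* The inputs are initially on stacks 0, 1, 2, ..., the other stacks being
   empty; the output is read on stack 0.  The top of a stack is the head of the
   sequence. *)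
Definition runs (p : program) (inputs : seq (seq bool)) (output : seq bool)
    (t : nat) : Prop :=
  exists m, exec p (nth [::] inputs) m t /\ m 0%N = output.

(* Quantum circuits over the universal gate set {H, T, CNOT}.  The input
   occupies the first cin wires, the other wires are ancillas initialized to 0,
   and the output consists of the first cout wires, the others being discarded
   (traced out).  Intermediate measurements are deferred; a classical input is a
   computational basis state, and a classical output is the result of measuring
   the output wires in the computational basis. *)

Inductive gate :=
| HGate of nat
| TGate of nat
| CnotGate of nat & nat. (* control, target *)

Record circuit := Circuit {
  cin : nat;
  cout : nat;
  cwires : nat;
  cgates : seq gate }.

Definition gate_wf (w : nat) (g : gate) : bool :=
  match g with
  | HGate i | TGate i => (i < w)%N
  | CnotGate i j => [&& (i < w)%N, (j < w)%N & i != j]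
  end.

Definition circuit_wf (K : circuit) : bool :=
  [&& (cin K <= cwires K)%N, (cout K <= cwires K)%N
    & all (gate_wf (cwires K)) (cgates K)].

Definition unary (n : nat) : seq bool := nseq n true.

Definition encode_nat (n : nat) : seq bool := rcons (unary n) false.

Definition encode_gate (g : gate) : seq bool :=
  match g with
  | HGate i => [:: false; false] ++ encode_nat i
  | TGate i => [:: false; true] ++ encode_nat i
  | CnotGate i j => [:: true; false] ++ encode_nat i ++ encode_nat j
  end.

(* Wire numbers are in unary: an upper bound on the length of the description
   is also one on the number of wires and on the number of gates. *)
Definition encode_circuit (K : circuit) : seq bool :=
  encode_nat (cin K) ++ encode_nat (cout K) ++ encode_nat (cwires K) ++
  flatten [seq encode_gate g | g <- cgates K].

Definition uniform_family (K : nat -> circuit) : Prop :=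
  exists (p : program) (c : nat), forall l : nat, exists t : nat,
    runs p [:: unary l] (encode_circuit (K l)) t /\ (t <= c + l ^ c)%N.

(* A QPT algorithm on inputs of ni l qubits and outputs of no l qubits, where l
   is the security parameter. *)
Definition qpt (K : nat -> circuit) (ni no : nat -> nat) : Prop :=
  uniform_family K /\
  forall l, [/\ circuit_wf (K l), cin (K l) = ni l & cout (K l) = no l].

Section Quantum.
Variable R : realType.

(* An operator on n qubits is given by its matrix entries in the computational
   basis, indexed by bit strings; only the entries at strings of length n are
   meaningful. *)
Definition operator := seq bool -> seq bool -> R[i].

Definition is_density (n : nat) (rho : operator) : Prop :=
  (forall v : n.-tuple bool -> R[i],
     0 <= \sum_(x : n.-tuple bool) \sum_(y : n.-tuple bool)
            conjc (v x) * rho x y * v y) /\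
  \sum_(x : n.-tuple bool) rho x x = 1.

Definition basis_state (b : seq bool) : operator :=
  fun x y => ((x == b) && (y == b))%:R.

(* Tensor product, rho being on n qubits. *)
Definition tensor (n : nat) (rho sigma : operator) : operator :=
  fun x y => rho (take n x) (take n y) * sigma (drop n x) (drop n y).

Fixpoint copies (n t : nat) (rho : operator) : operator :=
  if t is t'.+1 then tensor n rho (copies n t' rho) else basis_state [::].

Definition inv_sqrt2 : R := (Num.sqrt 2)^-1.

(* The T gate is diag(1, exp(i pi / 4)). *)
Definition gate_entry (g : gate) (x y : seq bool) : R[i] :=
  match g with
  | HGate i =>
      if set_nth false x i false == set_nth false y i false
      then Complex ((-1) ^+ (nth false x i && nth false y i) * inv_sqrt2) 0
      else 0
  | TGate i =>
      if x == y then
        (if nth false x i then Complex inv_sqrt2 inv_sqrt2 else 1)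
      else 0
  | CnotGate i j =>
      (x == set_nth false y j (nth false y j (+) nth false y i))%:R
  end.

(* U rho U^* on w wires. *)
Definition apply_gate (w : nat) (rho : operator) (g : gate) : operator :=
  fun x y => \sum_(x' : w.-tuple bool) \sum_(y' : w.-tuple bool)
    gate_entry g x x' * rho x' y' * conjc (gate_entry g y y').

Definition run_circuit (K : circuit) (rho : operator) : operator :=
  let w := cwires K in
  let final := foldl (apply_gate w)
    (tensor (cin K) rho (basis_state (nseq (w - cin K) false))) (cgates K) in
  fun x y => \sum_(z : (w - cout K).-tuple bool) final (x ++ z) (y ++ z).

Definition outcome_prob (K : circuit) (rho : operator) (y : seq bool) : R :=
  complex.Re (run_circuit K rho y y).

Definition negligible (f : nat -> R) : Prop :=
  forall c : nat, exists N : nat, forall l : nat,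
    (N <= l)%N -> `|f l| < (l%:R ^+ c)^-1.

Definition bits (w i : nat) : seq bool :=
  mkseq (fun j => odd (i %/ 2 ^ j)) w.

Definition ceil_inv (eps : R) : nat := `|Num.ceil eps^-1|%N.

Definition ceil_log_inv (delta : R) : nat :=
  `|Num.ceil (ln delta^-1 / ln 2)|%N.

(* E l takes i < M l, written with ceil (log2 (M l)) bits, and n l qubits. *)
Definition test_family (E : nat -> circuit) (n M : nat -> nat) : Prop :=
  (forall l, (0 < M l)%N) /\
  qpt E (fun l => (up_log 2 (M l) + n l)%N) (fun=> 1%N).

Definition accept_prob (K : circuit) (M i : nat) (rho : operator) : R :=
  outcome_prob K (tensor (up_log 2 M) (basis_state (bits (up_log 2 M) i)) rho)
    [:: true].

(* T1 is a quantum algorithm with classical input (E, n, M, 1/eps, log 1/delta)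
   and quantum input rho^{(x) k}: a program which computes, from the classical
   input, the circuit to be run on the quantum input.  T2 is a computationally
   unbounded randomized algorithm: T2 i st is the distribution of its estimate.
   The arguments of k and of the time bound are rounded up to integers. *)
Definition WEST (k : nat -> nat -> nat -> nat -> nat) (T1 : program)
    (T2 : nat -> seq bool -> probability (measurableTypeR R) R) : Prop :=
  (exists c, forall n logM a d : nat,
     (k n logM a d <= c + (n + logM + a + d) ^ c)%N) /\
  forall (E : nat -> circuit) (n M : nat -> nat), test_family E n M ->
  exists c : nat, forall (l : nat) (eps delta : R),
    0 < eps < 1 -> 0 < delta < 1 ->
    let logM := up_log 2 (M l) in
    let a := ceil_inv eps in
    let d := ceil_log_inv delta in
    exists (K : circuit) (t : nat),
    [/\ runs T1
          [:: encode_circuit (E l); unary (n l); bits logM.+1 (M l);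
              unary a; unary d]
          (encode_circuit K) t,
        (t <= c + (size (encode_circuit (E l)) + n l + logM + a + d) ^ c)%N,
        circuit_wf K,
        cin K = (k (n l) logM a d * n l)%N
      & forall (rho : operator) (i : nat),
          is_density (n l) rho -> (i < M l)%N ->
          1 - delta <=
          \sum_(st : (cout K).-tuple bool)
             outcome_prob K (copies (n l) (k (n l) logM a d) rho) st *
             fine (T2 i st
               [set x : R | `|x - accept_prob (E l) (M l) i rho| <= eps]%classic)].

Record scheme := Scheme {
  eklen : nat -> nat;
  dklen : nat -> nat;
  mlen : nat -> nat;
  ctlen : nat -> nat;
  Gen : nat -> circuit;
  Enc : nat -> circuit;
  Dec : nat -> circuit }.

(* The message space at security parameter l is {0,1}^(mlen l); it must have at
   least two elements. *)
Definition UTE (S : scheme) : Prop :=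
  [/\ forall l, (0 < mlen S l)%N,
      qpt (Gen S) (fun=> 0%N) (fun l => (eklen S l + dklen S l)%N),
      qpt (Enc S) (fun l => (eklen S l + mlen S l)%N) (ctlen S)
    & qpt (Dec S) (fun l => (dklen S l + ctlen S l)%N) (mlen S)].

Definition key_prob (S : scheme) (l : nat) (ek dk : seq bool) : R :=
  outcome_prob (Gen S l) (basis_state [::]) (ek ++ dk).

Definition ciphertext (S : scheme) (l : nat) (ek m : seq bool) : operator :=
  run_circuit (Enc S l) (basis_state (ek ++ m)).

Definition correct_prob (S : scheme) (l : nat) (m : seq bool) : R :=
  \sum_(ek : (eklen S l).-tuple bool) \sum_(dk : (dklen S l).-tuple bool)
    key_prob S l ek dk *
    outcome_prob (Dec S l)
      (tensor (dklen S l) (basis_state dk) (ciphertext S l ek m)) m.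

Definition correct (S : scheme) : Prop :=
  exists nu : nat -> R, negligible nu /\
    forall (l : nat) (m : (mlen S l).-tuple bool), 1 - nu l <= correct_prob S l m.

(* The first stage of the two-stage adversary is split into A0, which outputs
   (m0, m1) and keeps an internal quantum state on qlen qubits, and A1, which is
   given that state and the ciphertexts and outputs st. *)
Record adversary := Adversary {
  qlen : nat -> nat;
  stlen : nat -> nat;
  A0 : nat -> circuit;
  A1 : nat -> circuit }.

Definition adversary_qpt (S : scheme) (t : nat -> nat) (A : adversary) : Prop :=
  qpt (A0 A) (fun=> 0%N) (fun l => (mlen S l + mlen S l + qlen A l)%N) /\
  qpt (A1 A) (fun l => (qlen A l + t l * ctlen S l)%N) (stlen A).

(* Unnormalized internal state of A on the event that it outputs (m0, m1). *)
Definition adversary_state (A : adversary) (l : nat) (m0 m1 : seq bool)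
    : operator :=
  fun x y => run_circuit (A0 A l) (basis_state [::])
               (m0 ++ m1 ++ x) (m0 ++ m1 ++ y).

(* B l st dk is the probability that the unbounded second stage outputs 1. *)
Definition game_prob (S : scheme) (t : nat -> nat) (A : adversary)
    (B : nat -> seq bool -> seq bool -> R) (b : bool) (l : nat) : R :=
  \sum_(ek : (eklen S l).-tuple bool) \sum_(dk : (dklen S l).-tuple bool)
  key_prob S l ek dk *
  \sum_(m0 : (mlen S l).-tuple bool) \sum_(m1 : (mlen S l).-tuple bool)
  \sum_(st : (stlen A l).-tuple bool)
    outcome_prob (A1 A l)
      (tensor (qlen A l) (adversary_state A l m0 m1)
        (copies (ctlen S l) (t l)
          (ciphertext S l ek (if b then m1 else m0)))) st *
    B l st dk.

Definition everlasting_secure (S : scheme) (t : nat -> nat) : Prop :=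
  forall (A : adversary) (B : nat -> seq bool -> seq bool -> R),
    adversary_qpt S t A ->
    (forall l st dk, 0 <= B l st dk <= 1) ->
    negligible (fun l => `|game_prob S t A B false l - game_prob S t A B true l|).

End Quantum.

(* Main.v *)
(* The attack runs shadow tomography on the ciphertexts, with the decryption
   keys as the indices of the tests: the test [dk] decrypts and returns the
   first bit of the message.  The classical string output by [T1] then lets an
   unbounded second stage, once it knows [dk], estimate the acceptance
   probability of that test.  By correctness this probability is close to 1 or
   to 0 according to the first bit of the encrypted message, so comparing the
   estimate with 1/2 distinguishes the two messages.  To make the first stage as
   simple as possible, the first bit of [m0] is the outcome of a measured
   Hadamard gate, every other bit of [m0] and [m1] being 0; the two games
   differ only if that outcome is 1, which halves the advantage. *)

Require Import Defs.
From mathcomp Require Import all_boot all_order all_algebra.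
From mathcomp Require Import all_classical all_reals all_analysis.
From mathcomp Require Import complex.
From mathcomp Require Import zify ring lra.

Set Implicit Arguments.
Unset Strict Implicit.
Unset Printing Implicit Defensive.

Import Order.TTheory GRing.Theory Num.Theory.

(** * Polynomial-time programs *)

Local Open Scope nat_scope.

(** The first stage must come from one polynomial-time program, whereas [WEST] only provides, for
    each [l], a circuit printed by [T1] from five inputs that depend on [l]. Most of the work on
    programs serves to compute these inputs from [unary l] and to compose with [T1]: a program
    consumes its inputs and leaves garbage, so each one is relocated to fresh stacks. The lengths of
    keys, messages and ciphertexts do not come with programs either; they are read off the headers
    of the descriptions of [Enc] and [Dec]. Correctness holds only on average over the keys. The
    advantage is therefore bounded below, key by key, by an expression affine in the decryption
    errors, which remains valid for bad keys because it is trivial there. Averaging it over the keys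
    is then mere linearity. *)

Lemma leq_expn_base (m n e : nat) : m <= n -> m ^ e <= n ^ e.
Proof. by case: e => // e; rewrite leq_exp2r. Qed.

(** The base is at least 2, so powers grow with the exponent and absorb constants, sums and
    products. This is more convenient than the form [c + l ^ c] of the definitions. *)
Definition poly_bounded (T : nat -> nat) : Prop :=
  exists c, forall l, T l <= l.+2 ^ c.

Lemma poly_boundedP (T : nat -> nat) :
  poly_bounded T <-> exists c, forall l, T l <= c + l ^ c.
Proof.
split=> -[c hc].
(* The term [3 ^ c] covers [l < 2], where powers of [l] do not grow; for larger [l],
   [l.+2 <= l ^ 2]. *)
- exists (3 ^ c + 2 * c) => l; apply: leq_trans (hc l) _.
  case: (ltnP l 2) => hl.
    apply: leq_trans (leq_addr _ _); apply: leq_trans (leq_addr _ _).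
    by apply: leq_expn_base.
  apply: leq_trans (leq_addl _ _).
  apply: (@leq_trans (l ^ (2 * c))); last by apply: leq_pexp2l; lia.
  by rewrite expnM; apply: leq_expn_base; nia.
- exists c.+1 => l; apply: leq_trans (hc l) _.
  have h1 : c <= l.+2 ^ c.
    apply: leq_trans (ltnW (ltn_expl c (isT : 1 < 2))) _.
    by apply: leq_expn_base.
  have h2 : l ^ c <= l.+2 ^ c by apply: leq_expn_base; lia.
  by rewrite expnS; nia.
Qed.

Lemma poly_bounded_le (T T' : nat -> nat) :
  (forall l, T l <= T' l) -> poly_bounded T' -> poly_bounded T.
Proof. by move=> h [c hc]; exists c => l; apply: leq_trans (h l) (hc l). Qed.

Lemma poly_bounded_const (n : nat) : poly_bounded (fun=> n).
Proof.
exists n => l; apply: leq_trans (ltnW (ltn_expl n (isT : 1 < 2))) _.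
by apply: leq_expn_base.
Qed.

Lemma poly_bounded_id : poly_bounded id.
Proof. by exists 1 => l; rewrite expn1; lia. Qed.

Lemma poly_boundedD (T T' : nat -> nat) :
  poly_bounded T -> poly_bounded T' -> poly_bounded (fun l => T l + T' l).
Proof.
move=> [c hc] [c' hc']; exists (c + c').+1 => l.
have h1 : l.+2 ^ c <= l.+2 ^ (c + c') by apply: leq_pexp2l; lia.
have h2 : l.+2 ^ c' <= l.+2 ^ (c + c') by apply: leq_pexp2l; lia.
by have := hc l; have := hc' l; rewrite expnS; nia.
Qed.

Lemma poly_boundedM (T T' : nat -> nat) :
  poly_bounded T -> poly_bounded T' -> poly_bounded (fun l => T l * T' l).
Proof.
by move=> [c hc] [c' hc']; exists (c + c') => l; rewrite expnD leq_mul.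
Qed.

Lemma poly_boundedX (T : nat -> nat) (c : nat) :
  poly_bounded T -> poly_bounded (fun l => T l ^ c).
Proof.
move=> [d hd]; exists (d * c) => l; rewrite expnM.
exact: leq_expn_base.
Qed.

(** * Stack programs: relocation, output length, moving and copying stacks *)

Fixpoint stack_bound (p : program) : nat :=
  match p with
  | Skip => 0
  | Push _ x | Pop x => x.+1
  | Seq p q => maxn (stack_bound p) (stack_bound q)
  | Case x p q r =>
      maxn x.+1 (maxn (stack_bound p) (maxn (stack_bound q) (stack_bound r)))
  | While x p => maxn x.+1 (stack_bound p)
  end.

Fixpoint rename_stacks (f : nat -> nat) (p : program) : program :=
  match p with
  | Skip => Skip
  | Push b x => Push b (f x)
  | Pop x => Pop (f x)
  | Seq p q => Seq (rename_stacks f p) (rename_stacks f q)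
  | Case x p q r =>
      Case (f x) (rename_stacks f p) (rename_stacks f q) (rename_stacks f r)
  | While x p => While (f x) (rename_stacks f p)
  end.

(** Relocation with a frame property: a program can run inside a larger memory, at the same cost,
    and everything outside the image of its stacks survives. Only stacks below [N] have to agree
    with the original memory. *)
Lemma exec_rename_stacks (N : nat) (f : nat -> nat) (p : program) (m m' : memory)
    (t : nat) (M : memory) :
  exec p m m' t -> stack_bound p <= N -> injective f ->
  (forall x, x < N -> M (f x) = m x) ->
  exists M', [/\ exec (rename_stacks f p) M M' t,
    forall x, x < N -> M' (f x) = m' x
    & forall y, (forall x, x < N -> y <> f x) -> M' y = M y].
Proof.
move=> e; elim: e M => {p m m' t}.
- by move=> m M _ _ h; exists M; split=> //; exact: ExSkip.
- move=> b x m M /= hx inj h; eexists; split; first exact: ExPush.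
  + by move=> y hy; rewrite /upd (inj_eq inj) !h //; lia.
  + by move=> y hy; rewrite /upd; case: eqP => // E; case: (hy x).
- move=> x m M /= hx inj h; eexists; split; first exact: ExPop.
  + by move=> y hy; rewrite /upd (inj_eq inj) !h //; lia.
  + by move=> y hy; rewrite /upd; case: eqP => // E; case: (hy x).
- move=> p q m m' m'' t t' _ IHp _ IHq M /= hN inj h.
  have [|M1 [e1 h1 f1]] := IHp M _ inj h; first lia.
  have [|M2 [e2 h2 f2]] := IHq M1 _ inj h1; first lia.
  exists M2; split=> //; first exact: ExSeq e1 e2.
  by move=> y hy; rewrite f2 // f1.
- move=> x p q r m m' t _ IH M /= hN inj h.
  have [|M1 [e1 h1 f1]] := IH M _ inj h.
    by case: (m x) => [|[] _]; lia.
  exists M1; split=> //; apply: ExCase.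
  by rewrite h; [case: (m x) e1 => [|[] s] | lia].
- move=> x p m mx M /= hN inj h; exists M; split=> //.
  by apply: ExWhileNil; rewrite h //; lia.
- move=> x p m m' m'' t t' mx _ IHp _ IHw M /= hN inj h.
  have [|M1 [e1 h1 f1]] := IHp M _ inj h; first lia.
  have [|M2 [e2 h2 f2]] := IHw M1 _ inj h1; first by rewrite /=; lia.
  exists M2; split=> //; last by move=> y hy; rewrite f2 // f1.
  by apply: ExWhileCons e1 e2; rewrite h //; lia.
Qed.

(** Each step pushes at most one bit, so a time bound also bounds the length of the output. *)
Lemma exec_size (p : program) (m m' : memory) (t : nat) :
  exec p m m' t -> forall x, size (m' x) <= size (m x) + t.
Proof.
elim=> {p m m' t}.
- by move=> m x; lia.
- by move=> b x m y; rewrite /upd; case: eqP => [->|_] /=; lia.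
- by move=> x m y; rewrite /upd; case: eqP => [->|_]; rewrite ?size_behead; lia.
- by move=> p q m m' m'' t t' _ h _ h' x; have := h x; have := h' x; lia.
- by move=> x p q r m m' t _ h y; have := h y; lia.
- by move=> x p m _ y; lia.
- by move=> x p m m' m'' t t' _ _ h _ h' y; have := h y; have := h' y; lia.
Qed.

Definition clear_stack (x : nat) : program := While x (Pop x).

Lemma exec_clear_stack (x : nat) (m : memory) :
  exists m', [/\ exec (clear_stack x) m m' (2 * size (m x) + 1), m' x = [::]
    & forall y, y != x -> m' y = m y].
Proof.
move E: (m x) => s; elim: s m E => [|b s IH] m mx.
  by exists m; split=> //; apply: ExWhileNil.
have [|m' [e h f]] := IH (upd m x (behead (m x))); first by rewrite /upd eqxx mx.
exists m'; split=> //.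
  have -> : 2 * size (b :: s) + 1 = (1 + (2 * size s + 1)).+1 by rewrite /=; lia.
  by apply: ExWhileCons e; [rewrite mx | apply: ExPop].
by move=> y hy; rewrite f // /upd (negbTE hy).
Qed.

Definition pour (x y : nat) : program :=
  While x (Case x Skip (Seq (Pop x) (Push false y)) (Seq (Pop x) (Push true y))).

Lemma exec_pour (x y : nat) (m : memory) : x != y ->
  exists m', [/\ exec (pour x y) m m' (4 * size (m x) + 1), m' x = [::],
    m' y = catrev (m x) (m y)
    & forall z, z != x -> z != y -> m' z = m z].
Proof.
move=> xy.
move E: (m x) => s; elim: s m E => [|b s IH] m mx.
  by exists m; split=> //; apply: ExWhileNil.
pose m1 := upd m x (behead (m x)).
have [|m' [e h h' f]] := IH (upd m1 y (b :: m1 y)).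
  by rewrite /upd (negbTE xy) /m1 /upd eqxx mx.
exists m'; split=> //.
- have -> : 4 * size (b :: s) + 1 = ((1 + 1).+1 + (4 * size s + 1)).+1
    by rewrite /=; lia.
  apply: ExWhileCons e; first by rewrite mx.
  apply: ExCase; rewrite mx.
  by case: (b); (apply: ExSeq; [exact: ExPop | exact: ExPush]).
- by rewrite h' /upd eqxx /m1 /upd eq_sym (negbTE xy).
- move=> z zx zy; rewrite f // /upd (negbTE zy) /m1 /upd.
  by rewrite (negbTE zx).
Qed.

(** One [pour] reverses the content; a second one through the scratch stack [z] restores the
    order. *)
Definition transfer (x z y : nat) : program := Seq (pour x z) (pour z y).

Lemma exec_transfer (x z y : nat) (m : memory) :
  x != y -> x != z -> z != y -> m z = [::] ->
  exists m', [/\ exec (transfer x z y) m m' (8 * size (m x) + 2), m' x = [::],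
    m' y = m x ++ m y
    & forall u, u != x -> u != y -> m' u = m u].
Proof.
move=> xy xz zy mz.
have [m1 [e1 h1 h1' f1]] := exec_pour m xz.
have [m2 [e2 h2 h2' f2]] := exec_pour m1 zy.
exists m2; split.
- have -> : 8 * size (m x) + 2 = (4 * size (m x) + 1) + (4 * size (m1 z) + 1).
    by rewrite h1' mz catrevE cats0 size_rev; lia.
  exact: ExSeq e1 e2.
- by rewrite f2.
- rewrite h2' h1' mz !catrevE cats0 revK f1 // eq_sym //.
- move=> u ux uy; case: (eqVneq u z) => [->|uz]; first by rewrite h2 mz.
  by rewrite f2 // f1.
Qed.

(** Reading a stack destroys it. The parameter is moved to the scratch stack [s.+1], then written
    back on stack 0 together with its copy, so that it remains available to the next program. *)
Definition unary_copy (s : nat) : program :=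
  Seq (pour 0 s.+1)
      (While s.+1 (Seq (Pop s.+1) (Seq (Push true 0) (Push true s)))).

Lemma exec_unary_copy (s n : nat) (m : memory) :
  0 < s -> m 0 = unary n -> m s = [::] -> m s.+1 = [::] ->
  exists m', [/\ exec (unary_copy s) m m' (8 * n + 2), m' s = unary n
    & forall u, u != s -> m' u = m u].
Proof.
move=> s0 m0 ms ms1.
have [//|m1 [e1 h1 h1' f1]] := @exec_pour 0 s.+1 m.
have hm1 : m1 s.+1 = unary n.
  by rewrite h1' ms1 m0 catrevE cats0 /unary rev_nseq.
have ms' : m1 s = [::] by rewrite f1; [exact: ms|lia|lia].
(* Invariant: [k] units are still on the scratch stack, and [j] are already on both targets. *)
have loop : forall k j m1, m1 s.+1 = unary k -> m1 0 = unary j -> m1 s = unary j ->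
  exists m', [/\ exec (While s.+1 (Seq (Pop s.+1) (Seq (Push true 0) (Push true s))))
      m1 m' (4 * k + 1), m' s.+1 = [::], m' 0 = unary (k + j), m' s = unary (k + j)
    & forall u, u != 0 -> u != s -> u != s.+1 -> m' u = m1 u].
  elim=> [|k IH] j M hk hj hj'.
    by exists M; split=> //; apply: ExWhileNil.
  pose M1 := upd M s.+1 (behead (M s.+1)).
  pose M2 := upd M1 0 (true :: M1 0).
  pose M3 := upd M2 s (true :: M2 s).
  have n1 : (s.+1 == s) = false by lia.
  have n2 : (s == s.+1) = false by lia.
  have n3 : (0 == s) = false by lia.
  have n4 : (s == 0) = false by lia.
  have [|||M' [e a b c d]] := IH j.+1 M3.
  - by rewrite /M3 /M2 /M1 /upd n1 eqxx hk.
  - by rewrite /M3 /M2 /M1 /upd /= n3 hj.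
  - by rewrite /M3 /M2 /M1 /upd eqxx n4 n2 hj'.
  exists M'; split; rewrite ?[k.+1 + j]addSnnS //.
    have -> : 4 * k.+1 + 1 = ((1 + (1 + 1)) + (4 * k + 1)).+1 by lia.
    apply: ExWhileCons e; first by rewrite hk.
    apply: ExSeq; first exact: ExPop.
    by apply: ExSeq; exact: ExPush.
  move=> u u0 us us1; rewrite d // /M3 /M2 /M1 /upd.
  by rewrite (negbTE us) (negbTE u0) (negbTE us1).
have [m2 [e a b c d]] := loop n 0 m1 hm1 h1 ms'.
rewrite addn0 in b c.
exists m2; split=> //.
  have -> : 8 * n + 2 = (4 * size (m 0) + 1) + (4 * n + 1).
    by rewrite m0 size_nseq; lia.
  exact: ExSeq e1 e.
move=> u us; case: (eqVneq u 0) => [->|u0]; first by rewrite b m0.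
case: (eqVneq u s.+1) => [->|us1]; first by rewrite a ms1.
by rewrite d // f1.
Qed.

(** * Functions of the security parameter computable in polynomial time *)

Definition polytime (F : nat -> seq bool) : Prop :=
  exists (p : program) (T : nat -> nat), poly_bounded T /\
    forall l, exists t, runs p [:: unary l] (F l) t /\ t <= T l.

Lemma uniform_familyP (K : nat -> circuit) :
  uniform_family K <-> polytime (fun l => encode_circuit (K l)).
Proof.
split=> [[p [c h]]|[p [T [/poly_boundedP[c hc] h]]]].
  by exists p, (fun l => c + l ^ c); split=> //; apply/poly_boundedP; exists c.
exists p, c => l; have [t [r ht]] := h l.
by exists t; split=> //; apply: leq_trans ht (hc l).
Qed.

Lemma polytime_size (F : nat -> seq bool) :
  polytime F -> poly_bounded (fun l => size (F l)).
Proof.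
move=> [p [T [hT h]]].
apply: (@poly_bounded_le _ (fun l => l + T l)); last first.
  exact: poly_boundedD poly_bounded_id hT.
move=> l; have [t [[m [e <-]] ht]] := h l.
by have := exec_size e 0; rewrite /= size_nseq; lia.
Qed.

(** Memory after several programs have run: the parameter is intact, the results sit at the
    positions [ps], and all stacks from [s] on are empty. The positions need not be consecutive,
    since garbage may lie between them. *)
Definition loaded (Fs : seq (nat -> seq bool)) (ps : seq nat) (s l : nat)
    (m : memory) : Prop :=
  [/\ m 0 = unary l,
      forall i, i < size ps -> m (nth 0 ps i) = nth [::] [seq F l | F <- Fs] i
    & forall y, s <= y -> m y = [::]].

(** By induction on the list: copy the parameter to the first free stack [s], run the next program
    shifted by [s], and move the free region beyond the stacks it may have used. *)
Lemma polytime_load (Fs : seq (nat -> seq bool)) :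
  (forall i, i < size Fs -> polytime (nth (fun=> [::]) Fs i)) ->
  exists (p : program) (T : nat -> nat) (ps : seq nat) (s : nat),
  [/\ poly_bounded T, [/\ size ps = size Fs, uniq ps, 0 < s
    & forall x, x \in ps -> 0 < x < s]
    & forall l, exists t m, [/\ exec p (nth [::] [:: unary l]) m t, t <= T l
        & loaded Fs ps s l m]].
Proof.
elim: Fs => [|F Fs IH] hF.
  exists Skip, (fun=> 1), [::], 1; split=> //; first exact: poly_bounded_const.
  move=> l; exists 1, (nth [::] [:: unary l]); split=> //; first exact: ExSkip.
  by split=> // -[|y] // _; case: y.
have [|p [T [ps [s [hT [sz un s0 hps] h]]]]] := IH.
  by move=> i hi; apply: (hF i.+1).
have [q [U [hU hq]]] := hF 0 isT.
(* The successor makes [N] positive, so that the output stack of [q] is covered even if [q] touches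
   no stack. *)
pose N := (stack_bound q).+1.
exists (Seq p (Seq (unary_copy s) (rename_stacks (addn s) q))).
exists (fun l => T l + ((8 * l + 2) + U l)), (s :: ps), (s + N); split.
- apply: (poly_boundedD hT); apply: (poly_boundedD _ hU).
  apply: poly_boundedD (poly_bounded_const _).
  exact: poly_boundedM (poly_bounded_const _) poly_bounded_id.
- split=> /=; rewrite ?sz ?un ?andbT //; try by lia.
  + by apply/negP => /hps; lia.
  + by move=> x; rewrite in_cons => /orP[/eqP->|/hps]; lia.
move=> l; have [t [m [e ht [m0 hm me]]]] := h l.
have [|m1 [e1 h1 f1]] := exec_unary_copy s0 m0 (me s (leqnn s)).
  by apply: me; lia.
have [t2 [[m2 [e2 h2]] ht2]] := hq l.
have [|||m3 [e3 h3 f3]] := @exec_rename_stacks N (addn s) _ _ _ _ m1 e2.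
- by rewrite /N; lia.
- exact: addnI.
- move=> [|x] _; first by rewrite addn0 h1.
  by rewrite /= nth_nil f1; [apply: me; lia|lia].
exists (t + ((8 * l + 2) + t2)), m3; split; last split.
- by apply: ExSeq e _; apply: ExSeq e1 e3.
- by rewrite !leq_add.
- rewrite f3; last by lia.
  by rewrite f1 //; lia.
- move=> [|i] hi /=; first by have := h3 0 isT; rewrite addn0 => ->.
  have /hps hin : nth 0 ps i \in ps by rewrite mem_nth.
  rewrite f3; last by lia.
  by rewrite f1 ?hm //; lia.
- move=> y hy; rewrite f3; last by lia.
  by rewrite f1; [apply: me; lia | lia].
Qed.

(** Closure under composition with a program of several inputs. The bound [T] is directly a function
    of [l], so the running time of [p] may depend on the arguments in any way that stays polynomial
    in [l]. *)
Lemma polytime_comp (Fs : seq (nat -> seq bool)) (G : nat -> seq bool)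
    (p : program) (T : nat -> nat) :
  (forall i, i < size Fs -> polytime (nth (fun=> [::]) Fs i)) ->
  poly_bounded T ->
  (forall l, exists t, runs p [seq F l | F <- Fs] (G l) t /\ t <= T l) ->
  polytime G.
Proof.
move=> hF hT hp.
have hG : poly_bounded (fun l => size (nth [::] [seq F l | F <- Fs] 0)).
  case: Fs hF {hp} => [|F Fs] hF /=; first exact: poly_bounded_const.
  exact: polytime_size (hF 0 isT).
have [q [U [ps [s [hU [sz un s0 hps] hq]]]]] := polytime_load hF.
(* The input stacks of [p] are renamed to the places where the arguments already lie, and its work
   stacks to free ones. The positions in [ps] are below [s], whence injectivity. *)
pose f i := if i < size ps then nth 0 ps i else s + i.
have finj : injective f.
  move=> i j; rewrite /f; case: ifP => hi; case: ifP => hj.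
  - by move/eqP; rewrite nth_uniq // => /eqP.
  - by move=> E; have := hps _ (mem_nth 0 hi); rewrite E; lia.
  - by move=> E; have := hps _ (mem_nth 0 hj); rewrite -E; lia.
  - by move/addnI.
pose N := maxn (size ps) (stack_bound p).+1.
have f_bd i : i < N -> 0 < f i < s + N.
  rewrite /f; case: ifP => hi; last by lia.
  by move: (hps _ (mem_nth 0 hi)); move: (nth 0 ps i) => x; lia.
have N0 : 0 < N by rewrite /N; lia.
pose z := s + N.
(* Stack 0 still holds the parameter and must be emptied before it receives the output. *)
exists (Seq q (Seq (rename_stacks f p) (Seq (clear_stack 0) (transfer (f 0) z 0)))).
exists (fun l => U l + (T l + ((2 * l + 1)
  + (8 * (size (nth [::] [seq F l | F <- Fs] 0) + T l) + 2)))); split.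
  by repeat first [assumption | exact: poly_bounded_id
    | exact: poly_bounded_const | apply: poly_boundedD | apply: poly_boundedM].
move=> l; have [t [m [e ht [m0 hm me]]]] := hq l.
have [t1 [[m1 [e1 h1]] ht1]] := hp l.
have [||x hx|m2 [e2 h2 f2]] := @exec_rename_stacks N f _ _ _ _ m e1.
- by rewrite /N; lia.
- exact: finj.
- rewrite /f; case: ifP => hi; first exact: hm.
  by rewrite me ?nth_default ?size_map //; lia.
have [m3 [e3 h3 f3]] := exec_clear_stack 0 m2.
have f0 := f_bd 0 N0.
have [||||m4 [e4 h4 h4' f4]] := @exec_transfer (f 0) z 0 m3.
- by lia.
- by rewrite /z; lia.
- by rewrite /z; lia.
- rewrite f3; last by rewrite /z; lia.
  rewrite f2; last by move=> x /f_bd; rewrite /z; lia.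
  by apply: me; rewrite /z; lia.
have m20 : m2 0 = unary l by rewrite f2 // => x /f_bd; lia.
have m3f : m3 (f 0) = G l by rewrite f3 ?h2 //; lia.
exists (t + (t1 + ((2 * size (m2 0) + 1) + (8 * size (m3 (f 0)) + 2)))); split.
  exists m4; split; last by rewrite h4' m3f h3 cats0.
  by apply: ExSeq e _; apply: ExSeq e2 _; apply: ExSeq e3 e4.
have := exec_size e1 0; rewrite h1 m20 m3f size_nseq.
by move=> hs; repeat apply: leq_add => //; lia.
Qed.

Lemma polytime_comp1 (F G : nat -> seq bool) (p : program) (T : nat -> nat) :
  polytime F -> poly_bounded T ->
  (forall l, exists t, runs p [:: F l] (G l) t /\ t <= T l) -> polytime G.
Proof. by move=> hF; apply: (@polytime_comp [:: F]); case. Qed.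

Lemma polytime_comp2 (F F' G : nat -> seq bool) (p : program) (T : nat -> nat) :
  polytime F -> polytime F' -> poly_bounded T ->
  (forall l, exists t, runs p [:: F l; F' l] (G l) t /\ t <= T l) -> polytime G.
Proof. by move=> hF hF'; apply: (@polytime_comp [:: F; F']); case=> [|[]]. Qed.

Lemma eq_polytime (F G : nat -> seq bool) : F =1 G -> polytime F -> polytime G.
Proof. by move=> /funext ->. Qed.

Lemma polytime_const (s : seq bool) : polytime (fun=> s).
Proof.
apply: (@polytime_comp [::] _ (foldr (fun b p => Seq p (Push b 0)) Skip s)
  (fun=> (size s).+1)) => //; first exact: poly_bounded_const.
move=> l; exists (size s).+1; split=> //=.
elim: s => [|b s [m [e h]]]; first by exists (nth [::] [::]); split; first exact: ExSkip.
exists (upd m 0 (b :: m 0)); split; last by rewrite /upd eqxx h.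
by rewrite /= -addn1; exact: ExSeq e (ExPush _ _ _).
Qed.

Lemma polytime_cat (F G : nat -> seq bool) :
  polytime F -> polytime G -> polytime (fun l => F l ++ G l).
Proof.
move=> hF hG.
pose p := Seq (pour 0 2) (Seq (transfer 1 3 0) (pour 2 0)).
apply: (@polytime_comp2 F G _ p
  (fun l => (4 * size (F l) + 1) + ((8 * size (G l) + 2) + (4 * size (F l) + 1)))).
- by [].
- by [].
- have sF := polytime_size hF; have sG := polytime_size hG.
  by repeat first [assumption | exact: poly_bounded_const
    | apply: poly_boundedD | apply: poly_boundedM].
move=> l; eexists; split; last exact: leqnn.
have [//|m1 [e1 a1 b1 c1]] := @exec_pour 0 2 (nth [::] [:: F l; G l]).
have m11 : m1 1 = G l by rewrite c1.
have [//|//|//||m2 [e2 a2 b2 c2]] := @exec_transfer 1 3 0 m1.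
  by rewrite c1.
have [//|m3 [e3 a3 b3 c3]] := @exec_pour 2 0 m2.
have m22 : m2 2 = rev (F l) by rewrite c2 // b1 catrevE cats0.
exists m3; split; last by rewrite b3 b2 a1 m22 cats0 catrevE revK m11.
apply: ExSeq e1 _; rewrite -m11; apply: ExSeq e2 _.
by move: e3; rewrite m22 size_rev.
Qed.

(** Serves both to skip a field of an encoding and to subtract unary numbers. *)
Lemma polytime_drop (F G : nat -> seq bool) :
  polytime F -> polytime G -> polytime (fun l => drop (size (F l)) (G l)).
Proof.
move=> hF hG.
apply: (@polytime_comp2 G F _ (While 1 (Seq (Pop 1) (Pop 0)))
  (fun l => 3 * size (F l) + 1)) => //.
  apply: poly_boundedD (poly_bounded_const _).
  exact: poly_boundedM (poly_bounded_const _) (polytime_size hF).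
move=> l; eexists; split; last exact: leqnn.
rewrite /runs; set m := nth _ _.
have : m 0 = G l by [].
have : m 1 = F l by [].
move: m.
elim: (F l) (G l) => [|b s IH] g m m1 m0.
  by exists m; split; [exact: ExWhileNil | rewrite drop0].
pose m' := upd (upd m 1 (behead (m 1))) 0 (behead (m 0)).
have [||m'' [e h]] := IH (behead g) m'.
- by rewrite /m' /upd /= m1.
- by rewrite /m' /upd /= m0.
exists m''; split; last by rewrite h /= -drop1 drop_drop addn1.
have -> : 3 * size (b :: s) + 1 = ((1 + 1) + (3 * size s + 1)).+1
  by rewrite /=; lia.
apply: ExWhileCons e; first by rewrite m1.
apply: ExSeq (ExPop _ _) _; exact: ExPop.
Qed.

Lemma polytime_nseq_false (F : nat -> seq bool) :
  polytime F -> polytime (fun l => nseq (size (F l)) false).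
Proof.
move=> hF.
pose p := Seq (While 0 (Seq (Pop 0) (Push false 1))) (pour 1 0).
apply: (@polytime_comp1 F _ p
  (fun l => (3 * size (F l) + 1) + (4 * size (F l) + 1))) => //.
  have sF := polytime_size hF.
  by repeat first [assumption | exact: poly_bounded_const
    | apply: poly_boundedD | apply: poly_boundedM].
move=> l; eexists; split; last exact: leqnn.
have loop : forall s n m, m 0 = s -> m 1 = nseq n false -> exists m', [/\
    exec (While 0 (Seq (Pop 0) (Push false 1))) m m' (3 * size s + 1),
    m' 0 = [::] & m' 1 = nseq (size s + n) false].
  elim=> [|b s IH] n m m0 m1.
    by exists m; split=> //; exact: ExWhileNil.
  pose m' := upd m 0 (behead (m 0)).
  have [||m'' [e h h']] := IH n.+1 (upd m' 1 (false :: m' 1)).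
  - by rewrite /m' /upd /= m0.
  - by rewrite /m' /upd /= m1.
  exists m''; split=> //; last by rewrite h' /= addnS.
  have -> : 3 * size (b :: s) + 1 = ((1 + 1) + (3 * size s + 1)).+1
    by rewrite /=; lia.
  apply: ExWhileCons e; first by rewrite m0.
  apply: ExSeq (ExPop _ _) _; exact: ExPush.
have [m1 [e1 a1 b1]] := loop (F l) 0 (nth [::] [:: F l]) erefl erefl.
have [//|m2 [e2 a2 b2 c2]] := @exec_pour 1 0 m1.
exists m2; split; last by rewrite b2 a1 b1 addn0 catrevE cats0 rev_nseq.
apply: ExSeq e1 _; move: e2; by rewrite b1 addn0 size_nseq.
Qed.

(** * Reading and editing circuit descriptions *)

Definition unary_prefix (s : seq bool) : seq bool := unary (index false s).

Lemma polytime_unary_prefix (F : nat -> seq bool) :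
  polytime F -> polytime (fun l => unary_prefix (F l)).
Proof.
move=> hF.
(* A loop can only test for emptiness, so stack 1 holds a flag: it is popped at the terminating
   [false] or at the end of the string, which stops the loop. *)
pose w := While 1 (Case 0 (Pop 1) (Pop 1) (Seq (Pop 0) (Push true 2))).
pose p := Seq (Push true 1) (Seq w (Seq (clear_stack 0) (pour 2 0))).
apply: (@polytime_comp1 F _ p
  (fun l => 1 + ((4 * size (F l) + 4) + ((2 * size (F l) + 1)
     + (4 * size (F l) + 1))))) => //.
  have sF := polytime_size hF.
  by repeat first [assumption | exact: poly_bounded_const
    | apply: poly_boundedD | apply: poly_boundedM].
move=> l.
pose m1 := upd (nth [::] [:: F l]) 1 (true :: nth [::] [:: F l] 1).
have loop : forall s n m, m 0 = s -> m 1 = [:: true] -> m 2 = unary n ->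
    exists m' t, [/\ exec w m m' t, t <= 4 * size s + 4,
      size (m' 0) <= size s & m' 2 = unary (index false s + n)].
  elim=> [|b s IH] n m h0 h1 h2.
    exists (upd m 1 (behead (m 1))), (1.+1 + 1).+1; split=> //.
    - apply: (@ExWhileCons _ _ _ (upd m 1 (behead (m 1)))); first by rewrite h1.
        by apply: ExCase; rewrite h0; exact: ExPop.
      by apply: ExWhileNil; rewrite /upd /= h1.
    - by rewrite /upd /= h0.
  case: b h0 => h0; last first.
    exists (upd m 1 (behead (m 1))), (1.+1 + 1).+1; split=> //=.
    - apply: (@ExWhileCons _ _ _ (upd m 1 (behead (m 1)))); first by rewrite h1.
        by apply: ExCase; rewrite h0; exact: ExPop.
      by apply: ExWhileNil; rewrite /upd /= h1.
    - by lia.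
    - by rewrite /upd /= h0.
  pose m' := upd m 0 (behead (m 0)).
  have [|||m'' [t [e ht hs h]]] := IH n.+1 (upd m' 2 (true :: m' 2)).
  - by rewrite /m' /upd /= h0.
  - by rewrite /m' /upd /= h1.
  - by rewrite /m' /upd /= h2.
  exists m'', ((1 + 1).+1 + t).+1; split=> //=.
  - apply: ExWhileCons e; first by rewrite h1.
    apply: ExCase; rewrite h0; apply: ExSeq (ExPop _ _) _; exact: ExPush.
  - by lia.
  - by lia.
  - by rewrite h addnS.
have [m2 [t [e ht hs m22]]] := loop (F l) 0 m1 erefl erefl erefl.
have [m3 [e3 a3 b3]] := exec_clear_stack 0 m2.
have [//|m4 [e4 a4 b4 c4]] := @exec_pour 2 0 m3.
exists (1 + (t + ((2 * size (m2 0) + 1) + (4 * size (m3 2) + 1)))); split.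
  exists m4; split; last first.
    by rewrite b4 a3 b3 // m22 addn0 catrevE cats0 /unary rev_nseq.
  by apply: ExSeq (ExPush _ _ _) _; apply: ExSeq e _; apply: ExSeq e3 e4.
by rewrite b3 // m22 size_nseq addn0 !leq_add ?leq_mul ?index_size.
Qed.

Lemma unary_prefix_encode (n : nat) (s : seq bool) :
  unary_prefix (encode_nat n ++ s) = unary n.
Proof.
rewrite /unary_prefix /encode_nat cat_rcons; congr unary.
by elim: n => //= n ->.
Qed.

Lemma drop_encode_nat (n : nat) (s : seq bool) :
  drop (size (true :: unary n)) (encode_nat n ++ s) = s.
Proof. by rewrite drop_size_cat // size_rcons. Qed.

(** Only the length of [true :: _] matters: the additional bit accounts for the terminating
    [false]. *)
Definition after_prefix (s : seq bool) : seq bool :=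
  drop (size (true :: unary_prefix s)) s.

Lemma after_prefix_encode (n : nat) (s : seq bool) :
  after_prefix (encode_nat n ++ s) = s.
Proof. by rewrite /after_prefix unary_prefix_encode drop_encode_nat. Qed.

Lemma polytime_after_prefix (F : nat -> seq bool) :
  polytime F -> polytime (fun l => after_prefix (F l)).
Proof.
move=> hF; apply: (@polytime_drop (fun l => true :: unary_prefix (F l))) => //.
apply: (@polytime_cat (fun=> [:: true])); first exact: polytime_const.
exact: polytime_unary_prefix.
Qed.

Lemma polytime_cin (K : nat -> circuit) :
  uniform_family K -> polytime (fun l => unary (cin (K l))).
Proof.
move=> /uniform_familyP /polytime_unary_prefix; apply: eq_polytime => l.
by rewrite /encode_circuit unary_prefix_encode.
Qed.

Lemma polytime_cout (K : nat -> circuit) :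
  uniform_family K -> polytime (fun l => unary (cout (K l))).
Proof.
move=> /uniform_familyP /polytime_after_prefix /polytime_unary_prefix.
by apply: eq_polytime => l; rewrite after_prefix_encode unary_prefix_encode.
Qed.

Lemma polytime_encode_nat (f : nat -> nat) :
  polytime (fun l => unary (f l)) -> polytime (fun l => encode_nat (f l)).
Proof.
move=> hf; apply: (@eq_polytime (fun l => unary (f l) ++ [:: false])).
  by move=> l; rewrite cats1.
exact: polytime_cat hf (polytime_const _).
Qed.

(** Lowering [cout] traces out the remaining output wires; [set_cout 1] thus measures the first
    output bit alone. *)
Definition set_cout (c : nat) (K : circuit) : circuit :=
  Circuit (cin K) c (cwires K) (cgates K).

(** Only the second field of the header changes; what follows it is copied verbatim. *)
Lemma uniform_family_set_cout (c : nat) (K : nat -> circuit) :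
  uniform_family K -> uniform_family (fun l => set_cout c (K l)).
Proof.
move=> hK; apply/uniform_familyP.
apply: (polytime_cat (polytime_encode_nat (polytime_cin hK))).
apply: (polytime_cat (polytime_const _)).
move/uniform_familyP : hK => /polytime_after_prefix /polytime_after_prefix.
by apply: eq_polytime => l; rewrite !after_prefix_encode.
Qed.

(** * Keys as binary indices, and the inputs of [T1] *)

Fixpoint nat_of_bits (s : seq bool) : nat :=
  if s is b :: s' then b + (nat_of_bits s').*2 else 0.

Lemma bitsS (w i : nat) : bits w.+1 i = odd i :: bits w i./2.
Proof.
rewrite /bits /mkseq /= expn0 divn1; congr cons.
rewrite (iotaDl 1 0) -map_comp; apply: eq_map => j /=.
by rewrite expnS divnMA divn2.
Qed.

Lemma bits_nat_of_bits (s : seq bool) : bits (size s) (nat_of_bits s) = s.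
Proof.
elim: s => [//|b s IH]; rewrite [size _]/= bitsS /= oddD odd_double addbF.
by rewrite oddb half_bit_double IH.
Qed.

Lemma nat_of_bits_lt (s : seq bool) : nat_of_bits s < 2 ^ size s.
Proof. by elim: s => //= b s IH; rewrite expnS; case: b; lia. Qed.

(** The number of tests is exponential in [w], but its binary form, least significant bit first, is
    easily printed from [unary w]. *)
Lemma bits_exp2 (w : nat) : bits w.+1 (2 ^ w) = nseq w false ++ [:: true].
Proof.
rewrite -[RHS]bits_nat_of_bits size_cat size_nseq addn1; congr bits.
by elim: w => //= w <-; rewrite add0n expnS mul2n.
Qed.

Lemma uniform_family_shadow (E K : nat -> circuit) (n w : nat -> nat) (a d c : nat)
    (T1 : program) :
  uniform_family E -> polytime (fun l => unary (n l)) ->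
  polytime (fun l => unary (w l)) ->
  (forall l, exists t, runs T1
      [:: encode_circuit (E l); unary (n l); bits (w l).+1 (2 ^ w l);
          unary a; unary d] (encode_circuit (K l)) t /\
    t <= c + (size (encode_circuit (E l)) + n l + w l + a + d) ^ c) ->
  uniform_family K.
Proof.
move=> /uniform_familyP hE hn hw h; apply/uniform_familyP.
apply: (polytime_comp (Fs := [:: fun l => encode_circuit (E l);
  fun l => unary (n l); fun l => bits (w l).+1 (2 ^ w l); fun=> unary a;
  fun=> unary d]) _ _ h).
- move=> [//|[//|[_|[_|[_|//]]]]] /=; try exact: polytime_const.
  apply: (@eq_polytime (fun l => nseq (size (unary (w l))) false ++ [:: true])).
    by move=> l; rewrite size_nseq bits_exp2.
  apply: polytime_cat (polytime_const _).
  exact: polytime_nseq_false.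
- have sE := polytime_size hE.
  have sn : poly_bounded n.
    by apply: poly_bounded_le (polytime_size hn) => l; rewrite size_nseq.
  have sw : poly_bounded w.
    by apply: poly_bounded_le (polytime_size hw) => l; rewrite size_nseq.
  by repeat first [assumption | exact: poly_bounded_const
    | apply: poly_boundedD | apply: poly_boundedX].
Qed.

(** * Quantum circuits *)

Local Open Scope ring_scope.

(** Summands take plain sequences and the length is a free [N] with an equation, which avoids casts
    between tuple types. *)
Lemma sum_tuple_cat (V : nmodType) (n m N : nat) (F : seq bool -> V) :
  N = (n + m)%N ->
  \sum_(z : N.-tuple bool) F z =
  \sum_(x : n.-tuple bool) \sum_(y : m.-tuple bool) F (x ++ y).
Proof.
move=> ->; rewrite pair_bigA /=.
have tP (z : (n + m).-tuple bool) : size (take n z) == n.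
  by rewrite size_takel // size_tuple leq_addr.
have dP (z : (n + m).-tuple bool) : size (drop n z) == m.
  by rewrite size_drop size_tuple addKn.
rewrite (reindex (fun p : n.-tuple bool * m.-tuple bool =>
  [tuple of p.1 ++ p.2])) //=.
exists (fun z => (Tuple (tP z), Tuple (dP z))) => [[x y] _|z _].
  congr pair; apply: val_inj => /=.
    by rewrite take_size_cat // size_tuple.
  by rewrite drop_size_cat // size_tuple.
by apply: val_inj; rewrite /= cat_take_drop.
Qed.

Lemma sum_tuple0 (V : nmodType) (F : seq bool -> V) :
  \sum_(z : 0.-tuple bool) F z = F [::].
Proof. by rewrite (big_pred1 [tuple]) // => z; apply/esym/eqP; exact: tuple0. Qed.

Lemma sum_tuple_delta (A : pzRingType) (w : nat) (s : seq bool)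
    (F : seq bool -> A) : size s = w ->
  \sum_(x : w.-tuple bool) ((x : seq bool) == s)%:R * F x = F s.
Proof.
move=> /eqP hs; rewrite (bigD1 (Tuple hs)) //= eqxx mul1r big1 ?addr0 // => x.
by rewrite -val_eqE /= => /negbTE ->; rewrite mul0r.
Qed.

(** * Positivity and trace of operators, preserved by circuits *)

Section Operators.
Variable R : realType.
Implicit Types (rho sigma : operator R) (g : gate) (K : circuit).

Definition optrace (n : nat) rho : R[i] := \sum_(x : n.-tuple bool) rho x x.

(* Such operators are positive, and unlike positivity this property is
   immediately preserved by tensor products. *)
Definition mixture rho : Prop :=
  exists L : seq (seq bool -> R[i]),
    forall x y, rho x y = \sum_(f <- L) f x * conjc (f y).

Lemma mixture_basis_state (b : seq bool) : mixture (basis_state R b).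
Proof.
exists [:: fun x => (x == b)%:R] => x y.
by rewrite big_seq1 conjc_nat -natrM mulnb.
Qed.

Lemma mixture_tensor (n : nat) rho sigma :
  mixture rho -> mixture sigma -> mixture (tensor n rho sigma).
Proof.
move=> [L hL] [L' hL'].
exists [seq (fun x => f (take n x) * f' (drop n x)) | f <- L, f' <- L'] => x y.
rewrite big_allpairs_dep /tensor hL hL' mulr_suml; apply: eq_bigr => f _.
rewrite mulr_sumr; apply: eq_bigr => f' _.
by rewrite rmorphM /=; ring.
Qed.

Lemma mixture_copies (n t : nat) rho : mixture rho -> mixture (copies n t rho).
Proof.
move=> h; elim: t => [|t IH] /=; first exact: mixture_basis_state.
exact: mixture_tensor.
Qed.

Lemma mixture_apply_gate (w : nat) rho g :
  mixture rho -> mixture (apply_gate w rho g).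
Proof.
move=> [L hL].
exists [seq (fun x : seq bool =>
  \sum_(x' : w.-tuple bool) gate_entry R g x x' * f (tval x')) | f <- L] => x y.
rewrite big_map /apply_gate.
transitivity (\sum_(x' : w.-tuple bool) \sum_(f <- L) \sum_(y' : w.-tuple bool)
    gate_entry R g x x' * (f x' * conjc (f y')) * conjc (gate_entry R g y y')).
  apply: eq_bigr => x' _; rewrite exchange_big /=; apply: eq_bigr => y' _.
  by rewrite hL mulr_sumr mulr_suml.
rewrite exchange_big /=; apply: eq_bigr => f _.
rewrite mulr_suml; apply: eq_bigr => x' _.
rewrite rmorph_sum mulr_sumr; apply: eq_bigr => y' _.
by rewrite rmorphM /=; ring.
Qed.

Lemma mixture_run_circuit K rho : mixture rho -> mixture (run_circuit K rho).
Proof.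
move=> h; rewrite /run_circuit.
set r0 := tensor _ _ _.
have: mixture r0 by apply: mixture_tensor => //; exact: mixture_basis_state.
move: r0 => r0 h0.
have: mixture (foldl (apply_gate (cwires K)) r0 (cgates K)).
  elim: (cgates K) r0 h0 => [|g gs IH] r0 h0 //=.
  by apply: IH; exact: mixture_apply_gate.
move: (foldl _ _ _) => r [L hL].
exists [seq (fun x : seq bool => f (x ++ tval z)) |
  z <- enum {: (cwires K - cout K).-tuple bool}, f <- L] => x y.
rewrite big_allpairs_dep big_enum /=.
by apply: eq_bigr => z _; rewrite hL.
Qed.

Lemma mixture_ge0 rho (x : seq bool) : mixture rho -> 0 <= rho x x.
Proof. by move=> [L ->]; apply: sumr_ge0 => f _; exact: mulcJ_ge0. Qed.

(** The quadratic form at [v] is the sum over [f] of the squared moduli of the inner products of [v]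
    and [f]. *)
Lemma mixture_density (n : nat) rho :
  mixture rho -> optrace n rho = 1 -> is_density n rho.
Proof.
move=> [L hL] ht; split=> // v.
have -> : \sum_(x : n.-tuple bool) \sum_(y : n.-tuple bool)
    conjc (v x) * rho x y * v y =
  \sum_(f <- L) (\sum_(x : n.-tuple bool) conjc (v x) * f x) *
    conjc (\sum_(y : n.-tuple bool) conjc (v y) * f y).
  transitivity (\sum_(x : n.-tuple bool) \sum_(f <- L) \sum_(y : n.-tuple bool)
      conjc (v x) * (f x * conjc (f y)) * v y).
    apply: eq_bigr => x _; rewrite exchange_big /=; apply: eq_bigr => y _.
    by rewrite hL mulr_sumr mulr_suml.
  rewrite exchange_big /=; apply: eq_bigr => f _.
  rewrite mulr_suml; apply: eq_bigr => x _.
  rewrite rmorph_sum mulr_sumr; apply: eq_bigr => y _.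
  by rewrite rmorphM /= conjcK; ring.
by apply: sumr_ge0 => f _; exact: mulcJ_ge0.
Qed.

Lemma optrace_basis_state (b : seq bool) :
  optrace (size b) (basis_state R b) = 1.
Proof.
rewrite -[RHS](sum_tuple_delta (fun=> 1 : R[i]) (erefl (size b))).
by apply: eq_bigr => x _; rewrite mulr1 /basis_state andbb.
Qed.

Lemma optrace_tensor (n m : nat) rho sigma :
  optrace (n + m) (tensor n rho sigma) = optrace n rho * optrace m sigma.
Proof.
rewrite /optrace (sum_tuple_cat (fun z => tensor n rho sigma z z) erefl).
rewrite mulr_suml; apply: eq_bigr => x _; rewrite mulr_sumr; apply: eq_bigr => y _.
by rewrite /tensor take_size_cat ?drop_size_cat ?size_tuple.
Qed.

Lemma optrace_copies (n t : nat) rho :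
  optrace n rho = 1 -> optrace (t * n) (copies n t rho) = 1.
Proof.
move=> h; elim: t => [|t IH]; first exact: (optrace_basis_state [::]).
by rewrite mulSn /= optrace_tensor h IH mulr1.
Qed.

Lemma inv_sqrt2_sqr : inv_sqrt2 R * inv_sqrt2 R = 2^-1.
Proof. by rewrite /inv_sqrt2 -invfM -expr2 sqr_sqrtr. Qed.

Lemma size_set_nth_lt (w i : nat) (b : bool) (s : seq bool) :
  size s = w -> (i < w)%N -> size (set_nth false s i b) = w.
Proof. by move=> <- h; rewrite size_set_nth; apply/maxn_idPr. Qed.

(** Turns the condition in a Hadamard entry into an equation that determines [x] once its bit [i] is
    known, so that sums over [x] collapse. *)
Lemma set_nth_eqE (w i : nat) (x y : seq bool) :
  size x = w -> size y = w -> (i < w)%N ->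
  (set_nth false x i false == set_nth false y i false) =
  (x == set_nth false y i (nth false x i)).
Proof.
move=> hx hy hi; apply/eqP/eqP => [E|->]; last first.
  by rewrite set_set_nth eqxx.
apply: (@eq_from_nth _ false) => [|j hj]; first by rewrite (size_set_nth_lt _ hy).
rewrite nth_set_nth /=; case: eqVneq => [->//|ji].
by have := congr1 (nth false ^~ j) E; rewrite !nth_set_nth /= (negbTE ji).
Qed.

Lemma gate_entry_unitary (w : nat) g (x y : w.-tuple bool) : gate_wf w g ->
  \sum_(z : w.-tuple bool) gate_entry R g z x * conjc (gate_entry R g z y)
  = (x == y)%:R.
Proof.
case: g => [i|i|i j] /= wf.
(* A Hadamard column has two nonzero entries, indexed by the new value [b] of wire [i]. *)
- have hE (z : w.-tuple bool) (u : w.-tuple bool) :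
      gate_entry R (HGate i) z u = \sum_(b : bool)
        ((z : seq bool) == set_nth false u i b)%:R
        * Complex ((-1) ^+ (b && nth false u i) * inv_sqrt2 R) 0.
    rewrite /= (set_nth_eqE (size_tuple z) (size_tuple u) wf).
    rewrite (bigD1 (nth false z i)) //= big1 ?addr0; last first.
      move=> b hb; case: eqP => [E|_]; last by rewrite mul0r.
      by move: hb; rewrite E nth_set_nth /= !eqxx.
    by case: ifP => _; rewrite ?mul1r ?mul0r.
  under eq_bigr => z _ do rewrite -/(gate_entry R (HGate i) z x) hE mulr_suml.
  rewrite exchange_big /=.
  under eq_bigr => b _ do (under eq_bigr => z _ do rewrite -mulrA;
    rewrite (sum_tuple_delta
      (fun z => _ * conjc (if set_nth false z i false == set_nth false y i false
        then Complex ((-1) ^+ (nth false z i && nth false y i) * inv_sqrt2 R) 0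
        else 0)) (size_set_nth_lt b (size_tuple x) wf))).
  have -> : (x == y) = (tval x == tval y) by [].
  under eq_bigr => b _ do rewrite nth_set_nth /= eqxx set_set_nth eqxx.
  rewrite (set_nth_eqE (size_tuple x) (size_tuple y) wf).
  case: (@eqP _ (tval x) (set_nth false y i (nth false x i))) => [E|ne]; last first.
    rewrite big1 => [|b _]; last by rewrite conjc0 mulr0.
    case: eqP => // E; case: ne; apply/eqP; rewrite E.
    by rewrite -(set_nth_eqE (size_tuple y) (size_tuple y) wf) eqxx.
  have -> : (tval x == tval y) = (nth false x i == nth false y i).
    apply/eqP/eqP => [->//|E']; rewrite E E'.
    apply: (@eq_from_nth _ false) => [|k _].
      exact: (etrans (size_set_nth_lt _ (size_tuple y) wf) (esym (size_tuple y))).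
    by rewrite nth_set_nth /=; case: eqP => [->|].
  rewrite big_bool /=; have h := inv_sqrt2_sqr.
  have h2 : 2^-1 + 2^-1 = 1 :> R by lra.
  by case: (nth false x i) (nth false y i) => -[] /=;
    apply/eqP; rewrite eq_complex /=; apply/andP; split; apply/eqP;
    rewrite ?expr1 ?expr0; nra.
- rewrite (bigD1 x) //= eqxx big1 ?addr0 => [|z hz]; last first.
    by rewrite (_ : (tval z == tval x) = false) ?mul0r //; exact/negbTE.
  rewrite val_eqE; case: (eqVneq x y) => [->|_]; last by rewrite conjc0 mulr0.
  case: ifP => _; last by rewrite conjc1 mulr1.
  have h := inv_sqrt2_sqr; apply/eqP; rewrite eq_complex /=.
  by apply/andP; split; apply/eqP; nra.
- have /and3P[hi hj ij] := wf.
  (* The gate permutes the basis by [f], an involution because the control differs from the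
     target. *)
  pose f (s : seq bool) := set_nth false s j (nth false s j (+) nth false s i).
  have fK (s : w.-tuple bool) : f (f s) = s.
    apply: (@eq_from_nth _ false) => [|k _].
      have h1 : size (f s) = w by exact: size_set_nth_lt (size_tuple s) hj.
      exact: (etrans (size_set_nth_lt _ h1 hj) (esym (size_tuple s))).
    rewrite /f !nth_set_nth /= eqxx (negbTE ij).
    by case: eqP => [->|/eqP/negbTE kj]; rewrite ?addbK // nth_set_nth /= kj.
  under eq_bigr => z _ do rewrite -/(f x) -/(f y).
  rewrite (sum_tuple_delta (fun z => conjc (z == f y)%:R)); last first.
    exact: size_set_nth_lt (size_tuple x) hj.
  rewrite conjc_nat; congr (nat_of_bool _)%:R.
  by apply/eqP/eqP => [E|->//]; apply: val_inj; rewrite /= -(fK x) E fK.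
Qed.

(** Summing over the diagonal first leaves the Gram matrix of the columns of the gate, which is the
    identity. *)
Lemma optrace_apply_gate (w : nat) rho g :
  gate_wf w g -> optrace w (apply_gate w rho g) = optrace w rho.
Proof.
move=> wf; rewrite /optrace /apply_gate exchange_big /=.
apply: eq_bigr => x' _; rewrite exchange_big /=.
rewrite (bigD1 x') //= [X in _ + X]big1 ?addr0 => [|y' ne]; last first.
  under eq_bigr => z _ do rewrite mulrAC.
  by rewrite -mulr_suml gate_entry_unitary // eq_sym (negbTE ne) mul0r.
under eq_bigr => z _ do rewrite mulrAC.
by rewrite -mulr_suml gate_entry_unitary // eqxx mul1r.
Qed.

Lemma optrace_run_circuit K rho :
  circuit_wf K -> optrace (cout K) (run_circuit K rho) = optrace (cin K) rho.
Proof.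
move=> /and3P[hi ho hg]; rewrite /run_circuit.
set r0 := tensor _ _ _.
have : optrace (cwires K) r0 = optrace (cin K) rho.
  rewrite -{1}(subnKC hi) optrace_tensor.
  have := optrace_basis_state (nseq (cwires K - cin K) false).
  by rewrite size_nseq => ->; rewrite mulr1.
move: r0 => r0 <-.
have <- : optrace (cwires K) (foldl (apply_gate (cwires K)) r0 (cgates K))
    = optrace (cwires K) r0.
  elim: (cgates K) hg r0 => [|g gs IH] //= /andP[hg hgs] r0.
  by rewrite IH // optrace_apply_gate.
rewrite /optrace [RHS](sum_tuple_cat
  (fun z => foldl (apply_gate (cwires K)) r0 (cgates K) z z)
  (esym (subnKC ho))) //.
Qed.

Lemma Re_sum (I : Type) (r : seq I) (P : pred I) (F : I -> R[i]) :
  complex.Re (\sum_(i <- r | P i) F i) = \sum_(i <- r | P i) complex.Re (F i).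
Proof. by apply: (big_morph (@complex.Re R)) => // -[a b] [c d]. Qed.

Lemma outcome_prob_ge0 K rho (y : seq bool) :
  mixture rho -> 0 <= outcome_prob K rho y.
Proof.
move=> h; have := mixture_ge0 y (mixture_run_circuit K h).
by rewrite lecE => /andP[].
Qed.

Lemma sum_outcome_prob K rho :
  circuit_wf K -> optrace (cin K) rho = 1 ->
  \sum_(y : (cout K).-tuple bool) outcome_prob K rho y = 1.
Proof.
by move=> wf h; rewrite -Re_sum -/(optrace _ _) optrace_run_circuit // h.
Qed.

(** An adversary without internal qubits has a scalar as unnormalized state, namely the probability
    of the messages it chose; with [outcome_probZ] this scalar leaves the circuit. *)
Lemma tensor0 (c : R[i]) rho sigma :
  rho [::] [::] = c -> tensor 0 rho sigma = fun x y => c * sigma x y.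
Proof.
by move=> <-; apply/funext => x; apply/funext => y; rewrite /tensor !take0 !drop0.
Qed.

Lemma run_circuitZ K (c : R[i]) rho :
  run_circuit K (fun x y => c * rho x y) = fun x y => c * run_circuit K rho x y.
Proof.
have hf w gs r : foldl (apply_gate w) (fun x y => c * r x y) gs
    = fun x y => c * foldl (@apply_gate R w) r gs x y.
  elim: gs r => //= g gs IH r; rewrite -IH; congr foldl.
  apply/funext => x; apply/funext => y; rewrite /apply_gate mulr_sumr.
  apply: eq_bigr => x' _; rewrite mulr_sumr; apply: eq_bigr => y' _; ring.
apply/funext => x; apply/funext => y; rewrite /run_circuit mulr_sumr.
rewrite -[X in foldl _ X](_ : (fun x y => c * tensor (cin K) rho
  (basis_state R (nseq (cwires K - cin K) false)) x y) = _) ?hf //.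
by apply/funext => u; apply/funext => v; rewrite /tensor mulrA.
Qed.

Lemma outcome_probZ K (c : R) rho (y : seq bool) :
  outcome_prob K (fun x y => c%:C%C * rho x y) y = c * outcome_prob K rho y.
Proof.
rewrite /outcome_prob run_circuitZ; case: (run_circuit _ _ _ _) => a b /=.
by rewrite mul0r subr0.
Qed.

End Operators.

(** * The attack *)

Definition message (n : nat) (b : bool) : seq bool := b :: nseq n.-1 false.

Lemma size_message (n : nat) (b : bool) : (0 < n)%N -> size (message n b) = n.
Proof. by case: n => //= n _; rewrite size_nseq. Qed.

(* The measured output is [message n b ++ message n false] for a uniform bit
   [b]. *)
Definition coin_circuit (n : nat) : circuit :=
  Circuit 0 (n + n) (n + n) [:: HGate 0].

Lemma uniform_family_coin (n : nat -> nat) :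
  polytime (fun l => unary (n l)) -> uniform_family (fun l => coin_circuit (n l)).
Proof.
move=> hn; apply/uniform_familyP.
have h2 : polytime (fun l => encode_nat (n l + n l)).
  apply: polytime_encode_nat.
  apply: (@eq_polytime (fun l => unary (n l) ++ unary (n l))).
    by move=> l; rewrite -nseqD.
  exact: polytime_cat.
apply: (polytime_cat (polytime_const (encode_nat 0))).
exact: (polytime_cat h2 (polytime_cat h2
  (polytime_const (flatten (map encode_gate [:: HGate 0]))))).
Qed.

Section Attack.
Variable R : realType.
Implicit Types (rho : operator R) (K : circuit).

(** The probability is written as a sum over the coin of delta factors, on which the sums over [m0]
    and [m1] in the game collapse. *)
Lemma run_coin_circuit (n : nat) (m0 m1 : n.-tuple bool) : (0 < n)%N ->
  run_circuit (coin_circuit n) (basis_state R [::]) (m0 ++ m1 ++ [::])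
    (m0 ++ m1 ++ [::]) =
  ((\sum_(b : bool) ((m0 : seq bool) == message n b)%:R *
     ((m1 : seq bool) == message n false)%:R * 2^-1)%:C)%C.
Proof.
move=> n0; rewrite /run_circuit /=.
rewrite subnn (sum_tuple0 (fun z : seq bool => apply_gate _ _ _ (_ ++ z) (_ ++ z))).
rewrite !cats0 ?subn0.
set x := m0 ++ m1; set z := nseq (n + n) false.
have sz : size z = (n + n)%N by rewrite size_nseq.
have sx : size x = (n + n)%N by rewrite size_cat !size_tuple.
have zE b : set_nth false z 0 b = message n b ++ message n false.
  by rewrite /z /message; case: (n) n0 => // k _; rewrite addSn /= nseqD.
(* The initial state is the projector on [z], so the diagonal entry is the squared modulus of a
   single matrix entry. *)
have -> : apply_gate (n + n) (tensor 0 (basis_state R [::]) (basis_state R z))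
    (HGate 0) x x
  = gate_entry R (HGate 0) x z * conjc (gate_entry R (HGate 0) x z).
  rewrite /apply_gate.
  rewrite -[X in X * _](sum_tuple_delta (gate_entry R (HGate 0) x) sz).
  rewrite -[X in conjc X](sum_tuple_delta (gate_entry R (HGate 0) x) sz).
  rewrite mulr_suml; apply: eq_bigr => x' _.
  rewrite rmorph_sum mulr_sumr; apply: eq_bigr => y' _.
  rewrite /tensor /basis_state !take0 !drop0 eqxx mul1r -mulnb natrM.
  by rewrite rmorphM /= conjc_nat; ring.
have z0 : nth false z 0 = false by rewrite nth_nseq; case: ifP.
rewrite [gate_entry _ _ _ _]/= (set_nth_eqE sx sz) ?addn_gt0 ?n0 // zE.
rewrite z0 andbF expr0 mul1r /x.
have catE b : (m0 ++ m1 == message n b ++ message n false) =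
    ((m0 : seq bool) == message n b) && ((m1 : seq bool) == message n false).
  by rewrite eqseq_cat // size_tuple size_message.
have n1 : nth false (m0 ++ m1) 0 = head false m0.
  by rewrite nth_cat size_tuple n0 nth0.
have [b [s ms]] : exists b s, tval m0 = b :: s.
  by case: (tval m0) (size_tuple m0) n0 => [<-//|b s]; exists b, s.
rewrite catE n1 big_bool ms /message [head _ _]/= !eqseq_cons.
case: (tval m1 == _); case: (s == _); case: b {ms} => /=; rewrite ?andbF ?andbT /=;
  rewrite ?conjc0 ?mul0r ?mulr0 ?mul1r ?addr0 ?add0r //;
  apply/eqP; rewrite eq_complex /= !(mulr0, mul0r, oppr0, subr0, addr0);
  by rewrite ?eqxx ?andbT ?inv_sqrt2_sqr.
Qed.

(** * The distribution of the first output bit *)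

Lemma sum_tuple1 (V : nmodType) (F : seq bool -> V) :
  \sum_(z : 1.-tuple bool) F z = F [:: true] + F [:: false].
Proof.
rewrite (reindex (fun b : bool => [tuple b])) ?big_bool //.
exists (fun z => thead z) => [//|z _]; apply: val_inj.
by case/tupleP: z => b z; rewrite [z]tuple0.
Qed.

Lemma sum_set_cout1 K rho : circuit_wf K -> (0 < cout K)%N ->
  optrace (cin K) rho = 1 ->
  outcome_prob (set_cout 1 K) rho [:: true]
  + outcome_prob (set_cout 1 K) rho [:: false] = 1.
Proof.
move=> /and3P[h1 h2 h3] h0 ht.
rewrite -(sum_tuple1 (outcome_prob (set_cout 1 K) rho)).
apply: (@sum_outcome_prob R (set_cout 1 K)) => //.
by rewrite /circuit_wf /= h1 h3 andbT (leq_trans h0 h2).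
Qed.

(** The right-hand side is a marginal, a sum of nonnegative terms over the other output bits, and
    [s] contributes one of them. *)
Lemma outcome_prob_set_cout1 K rho (b : bool) (s : seq bool) :
  circuit_wf K -> mixture rho -> size (b :: s) = cout K ->
  outcome_prob K rho (b :: s) <= outcome_prob (set_cout 1 K) rho [:: b].
Proof.
move=> /and3P[_ ho _] hr hs.
have -> : outcome_prob (set_cout 1 K) rho [:: b] =
    \sum_(y : (cout K).-1.-tuple bool) outcome_prob K rho (b :: y).
  rewrite -Re_sum; congr complex.Re; rewrite /run_circuit /=.
  apply: (sum_tuple_cat (fun z : seq bool => foldl _ _ _ (b :: z) (b :: z))).
  by move: ho; rewrite -hs /=; lia.
have hs' : size s == (cout K).-1 by rewrite -hs.
rewrite (bigD1 (Tuple hs')) //= lerDl sumr_ge0 // => y _.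
exact: outcome_prob_ge0.
Qed.

(** * Comparison of a random estimate with 1/2 *)

Section Threshold.
Variables (mu : probability (measurableTypeR R) R) (p eps : R).

Definition near_event : set R := [set x : R | `|x - p| <= eps]%classic.
Definition high_event : set R := [set x : R | 2^-1 < x]%classic.

Lemma measurable_near : measurable near_event.
Proof.
rewrite (_ : near_event = `[p - eps, p + eps]%classic); first exact: measurable_itv.
by apply/seteqP; split=> x; rewrite /near_event /= in_itv /= ler_distl.
Qed.

Lemma measurable_high : measurable high_event.
Proof.
rewrite (_ : high_event = `]2^-1, +oo[%classic); first exact: measurable_itv.
by apply/seteqP; split=> x; rewrite /high_event /= in_itv /= andbT.
Qed.

Lemma fine_probability_itv (A : set R) : measurable A ->
  0 <= fine (mu A) <= 1.
Proof.
move=> mA; have fA : mu A \is a fin_num by exact: fin_num_measure.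
by rewrite -!lee_fin fineK // measure_ge0 probability_le1.
Qed.

Lemma near_le_high : 2^-1 + eps < p -> fine (mu near_event) <= fine (mu high_event).
Proof.
move=> h; have mn := measurable_near; have mh := measurable_high.
rewrite fine_le ?fin_num_measure // le_measure ?inE //.
by move=> x; rewrite /near_event /high_event /= ler_distl; lra.
Qed.

(** Estimates within [eps] of [p] are then below 1/2, so the two events are disjoint. *)
Lemma high_le_near : p < 2^-1 - eps ->
  fine (mu high_event) <= 1 - fine (mu near_event).
Proof.
move=> h; have mn := measurable_near; have mh := measurable_high.
have mc := measurableC mn.
rewrite -[1 - _](_ : fine (mu (~` near_event)%classic) = _); last first.
  by rewrite probability_setC // fineB ?fin_num_measure.
rewrite fine_le ?fin_num_measure // le_measure ?inE //.
by move=> x; rewrite /near_event /high_event /= ler_distl => hx /andP[]; lra.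
Qed.

End Threshold.
End Attack.

(** * The game played by the coin adversary *)

Section Game.
Variables (R : realType) (S : scheme) (t : nat -> nat) (stlen : nat -> nat)
  (K : nat -> circuit) (B : nat -> seq bool -> seq bool -> R).

Definition coin_adversary : adversary :=
  Adversary (fun=> 0%N) stlen (fun l => coin_circuit (mlen S l)) K.

Definition final_prob (l : nat) (ek dk m : seq bool) : R :=
  \sum_(st : (stlen l).-tuple bool)
    outcome_prob (K l) (copies (ctlen S l) (t l) (ciphertext R S l ek m)) st *
    B l st dk.

(** [~~ b && b'] is the first bit of the encrypted message: [m1] starts with 0 and [m0] with the
    coin [b']. *)
Lemma game_prob_coin (b : bool) (l : nat) : (0 < mlen S l)%N ->
  game_prob S t coin_adversary B b l =
  \sum_(ek : (eklen S l).-tuple bool) \sum_(dk : (dklen S l).-tuple bool)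
    key_prob R S l ek dk *
    (\sum_(b' : bool) 2^-1 * final_prob l ek dk
       (message (mlen S l) (~~ b && b'))).
Proof.
move=> hm; rewrite /game_prob; apply: eq_bigr => ek _; apply: eq_bigr => dk _.
congr (_ * _).
transitivity (\sum_(m0 : (mlen S l).-tuple bool) \sum_(m1 : (mlen S l).-tuple bool)
  \sum_(b' : bool) ((m0 : seq bool) == message (mlen S l) b')%:R *
     (((m1 : seq bool) == message (mlen S l) false)%:R * (2^-1 *
     final_prob l ek dk (if b then tval m1 else tval m0)))).
  apply: eq_bigr => m0 _; apply: eq_bigr => m1 _.
  pose a : R := \sum_(b' : bool) ((m0 : seq bool) == message (mlen S l) b')%:R *
     ((m1 : seq bool) == message (mlen S l) false)%:R * 2^-1.
  transitivity (a * final_prob l ek dk (if b then tval m1 else tval m0)); last first.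
    by rewrite /a mulr_suml; apply: eq_bigr => b' _; ring.
  rewrite -(fun_if (@tval _ _)) /final_prob mulr_sumr; apply: eq_bigr => st _.
  rewrite mulrA -outcome_probZ; congr (outcome_prob _ _ _ * _).
  by apply: tensor0; exact: run_coin_circuit.
transitivity (\sum_(b' : bool) \sum_(m0 : (mlen S l).-tuple bool)
  ((m0 : seq bool) == message (mlen S l) b')%:R *
  (2^-1 * final_prob l ek dk (if b then message (mlen S l) false else m0))).
  rewrite [RHS]exchange_big /=; apply: eq_bigr => m0 _.
  rewrite exchange_big /=; apply: eq_bigr => b' _.
  rewrite -mulr_sumr; congr (_ * _).
  exact: (@sum_tuple_delta R _ _ (fun m1 : seq bool =>
    2^-1 * final_prob l ek dk (if b then m1 else tval m0)) (size_message false hm)).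
apply: eq_bigr => b' _.
rewrite (sum_tuple_delta (fun m0 => 2^-1 * final_prob l ek dk
  (if b then message (mlen S l) false else m0))) ?size_message //.
by case: b.
Qed.

Lemma game_prob_coin_sub (l : nat) : (0 < mlen S l)%N ->
  game_prob S t coin_adversary B false l - game_prob S t coin_adversary B true l =
  2^-1 * \sum_(ek : (eklen S l).-tuple bool) \sum_(dk : (dklen S l).-tuple bool)
    key_prob R S l ek dk *
    (final_prob l ek dk (message (mlen S l) true)
     - final_prob l ek dk (message (mlen S l) false)).
Proof.
move=> hm; rewrite !game_prob_coin // -sumrB mulr_sumr; apply: eq_bigr => ek _.
rewrite -sumrB mulr_sumr; apply: eq_bigr => dk _.
by rewrite !big_bool /=; lra.
Qed.

End Game.

(** * Keys, ciphertexts and decryption tests *)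

Section KeySpace.
Variables (R : realType) (S : scheme).
Hypothesis hS : UTE S.

Lemma key_prob_ge0 (l : nat) (ek dk : seq bool) : 0 <= key_prob R S l ek dk.
Proof. by apply: outcome_prob_ge0; exact: mixture_basis_state. Qed.

Lemma sum_key_prob (l : nat) :
  \sum_(ek : (eklen S l).-tuple bool) \sum_(dk : (dklen S l).-tuple bool)
    key_prob R S l ek dk = 1.
Proof.
case: hS => _ [_ /(_ l)[wf ci co]] _ _.
rewrite -(sum_tuple_cat (outcome_prob (Gen S l) (basis_state R [::])) co).
by apply: sum_outcome_prob => //; rewrite ci; exact: (optrace_basis_state R [::]).
Qed.

Lemma mixture_ciphertext (l : nat) (ek m : seq bool) :
  mixture (ciphertext R S l ek m).
Proof. by apply: mixture_run_circuit; exact: mixture_basis_state. Qed.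

Lemma optrace_ciphertext (l : nat) (ek : (eklen S l).-tuple bool) (m : seq bool) :
  size m = mlen S l -> optrace (ctlen S l) (ciphertext R S l ek m) = 1.
Proof.
move=> hm; case: hS => _ _ [_ /(_ l)[wf ci <-]] _.
rewrite optrace_run_circuit // ci -hm.
have := optrace_basis_state R (ek ++ m).
by rewrite size_cat size_tuple.
Qed.

(** The number of inputs of [Dec] minus the number of outputs of [Enc], both being header fields. *)
Lemma polytime_dklen : polytime (fun l => unary (dklen S l)).
Proof.
case: hS => _ _ [uE hE] [uD hD].
apply: (@eq_polytime (fun l =>
    drop (size (unary (cout (Enc S l)))) (unary (cin (Dec S l))))).
  move=> l; have [_ _ ->] := hE l; have [_ -> _] := hD l.
  by rewrite /unary size_nseq drop_nseq addnK.
exact: polytime_drop (polytime_cout uE) (polytime_cin uD).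
Qed.

Lemma polytime_ctlen : polytime (fun l => unary (ctlen S l)).
Proof.
case: hS => _ _ [uE hE] _; apply: eq_polytime (polytime_cout uE) => l.
by have [_ _ ->] := hE l.
Qed.

Lemma polytime_mlen : polytime (fun l => unary (mlen S l)).
Proof.
case: hS => _ _ _ [uD hD]; apply: eq_polytime (polytime_cout uD) => l.
by have [_ _ ->] := hD l.
Qed.

Definition decryption_test (l : nat) : circuit := set_cout 1 (Dec S l).

(** With a power of two, [up_log 2 M] is exactly [dklen], so the index register of the test is the
    key register of [Dec]. *)
Lemma test_family_decryption :
  test_family decryption_test (ctlen S) (fun l => (2 ^ dklen S l)%N).
Proof.
case: hS => hm _ _ [uD hD]; split; first by move=> l; rewrite expn_gt0.
split; first exact: uniform_family_set_cout.
move=> l; have [/and3P[h1 h2 h3] ci co] := hD l; split=> //=.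
  rewrite /circuit_wf /= h1 h3 andbT /=.
  by apply: leq_trans (hm l) _; rewrite -co.
by rewrite up_expnK.
Qed.

Definition decryption_prob (l : nat) (ek dk m : seq bool) : R :=
  outcome_prob (Dec S l)
    (tensor (dklen S l) (basis_state R dk) (ciphertext R S l ek m)) m.

Definition test_prob (l : nat) (ek dk m : seq bool) : R :=
  accept_prob (decryption_test l) (2 ^ dklen S l) (nat_of_bits dk)
    (ciphertext R S l ek m).

(** A full message is at most as likely as its first bit, and the two first-bit probabilities add up
    to 1, so decrypting correctly to a message that starts with 0 caps acceptance. The bounds by 1
    make the decryption errors nonnegative. *)
Lemma test_prob_bounds (l : nat) (ek : (eklen S l).-tuple bool)
    (dk : (dklen S l).-tuple bool) :
  let d b := decryption_prob l ek dk (message (mlen S l) b) in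
  let p b := test_prob l ek dk (message (mlen S l) b) in
  [/\ d true <= p true, p false <= 1 - d false & d true <= 1 /\ d false <= 1].
Proof.
case: hS => hm _ _ [uD /(_ l)[wf ci co]] d p.
pose rho b := tensor (dklen S l) (basis_state R dk)
  (ciphertext R S l ek (message (mlen S l) b)).
have rhoM b : mixture (rho b).
  apply: mixture_tensor; first exact: mixture_basis_state.
  exact: mixture_ciphertext.
have rhoT b : optrace (cin (Dec S l)) (rho b) = 1.
  rewrite ci optrace_tensor optrace_ciphertext ?size_message // mulr1.
  by rewrite -{1}(size_tuple dk) optrace_basis_state.
have pE b : p b = outcome_prob (decryption_test l) (rho b) [:: true].
  rewrite /p /test_prob /accept_prob up_expnK //.
  by rewrite -{2}(size_tuple dk) bits_nat_of_bits.
have hs b : size (message (mlen S l) b) = cout (Dec S l) by rewrite size_message.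
have hd b : d b <= outcome_prob (decryption_test l) (rho b) [:: b].
  exact: outcome_prob_set_cout1 wf (rhoM b) (hs b).
have h1 b : outcome_prob (decryption_test l) (rho b) [:: true]
    + outcome_prob (decryption_test l) (rho b) [:: false] = 1.
  by apply: sum_set_cout1 => //; rewrite co.
have h0 b b' : 0 <= outcome_prob (decryption_test l) (rho b) [:: b'].
  exact: outcome_prob_ge0.
rewrite !pE.
have := hd true; have := hd false; have := h1 true; have := h1 false.
have := h0 true false; have := h0 false true.
by split; [|lra|split; lra].
Qed.

End KeySpace.

(** * The advantage of the distinguisher *)

Section Distinguisher.
Variables (R : realType) (S : scheme) (t : nat -> nat) (K : nat -> circuit)
  (T2 : nat -> seq bool -> probability (measurableTypeR R) R) (eps delta : R).
Hypotheses (hS : UTE S) (heps : 0 < eps < 2^-1) (hdelta : 0 < delta < 2^-1).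
Hypothesis K_wf : forall l, circuit_wf (K l).
Hypothesis K_cin : forall l, cin (K l) = (t l * ctlen S l)%N.
Hypothesis K_shadow : forall l (rho : operator R) (i : nat),
  is_density (ctlen S l) rho -> (i < 2 ^ dklen S l)%N ->
  1 - delta <= \sum_(st : (cout (K l)).-tuple bool)
    outcome_prob (K l) (copies (ctlen S l) (t l) rho) st *
    fine (T2 i st (near_event
      (accept_prob (decryption_test S l) (2 ^ dklen S l) i rho) eps)).

Definition threshold (l : nat) (st dk : seq bool) : R :=
  fine (T2 (nat_of_bits dk) st (@high_event R)).

Lemma threshold_itv (l : nat) (st dk : seq bool) : 0 <= threshold l st dk <= 1.
Proof. by apply: fine_probability_itv; exact: measurable_high. Qed.

Notation W := (final_prob S t (fun l => cout (K l)) K threshold).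

(** A pointwise form of Markov's inequality. If both decryption probabilities exceed [2^-1 + eps],
    the acceptance probabilities are more than [eps] away from 1/2 on the right sides, and each
    estimate errs with probability at most [delta]. Otherwise some error divided by [2^-1 - eps] is
    at least 1, and the corresponding bound is trivial. *)
Lemma final_prob_sub (l : nat) (ek : (eklen S l).-tuple bool)
    (dk : (dklen S l).-tuple bool) :
  (1 - 2 * delta) - ((1 - decryption_prob R S l ek dk (message (mlen S l) true))
     + (1 - decryption_prob R S l ek dk (message (mlen S l) false))) / (2^-1 - eps)
  <= W l ek dk (message (mlen S l) true) - W l ek dk (message (mlen S l) false).
Proof.
have /andP[eps_gt0 eps_lt] := heps; have /andP[delta_gt0 delta_lt] := hdelta.
have hm : (0 < mlen S l)%N by case: hS.
have [d1 d0 [d1' d0']] := test_prob_bounds R hS ek dk.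
move: d1 d0 d1' d0'.
set d := decryption_prob _ _ _ _ _; set p := test_prob _ _ _ _ _.
move=> d1 d0 d1' d0'.
pose rho b := ciphertext R S l ek (message (mlen S l) b).
pose o b (st : seq bool) := outcome_prob (K l) (copies (ctlen S l) (t l) (rho b)) st.
have o0 b st : 0 <= o b st.
  apply: outcome_prob_ge0; apply: mixture_copies; exact: mixture_ciphertext.
have rhoT b : optrace (ctlen S l) (rho b) = 1.
  by apply: optrace_ciphertext; rewrite ?size_message.
have o1 b : \sum_(st : (cout (K l)).-tuple bool) o b st = 1.
  by apply: sum_outcome_prob => //; rewrite K_cin; exact: optrace_copies.
have hdk : (nat_of_bits dk < 2 ^ dklen S l)%N.
  by rewrite -{2}(size_tuple dk); exact: nat_of_bits_lt.
have sh b : 1 - delta <= \sum_(st : (cout (K l)).-tuple bool) o b st *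
    fine (T2 (nat_of_bits dk) st (near_event (p (message (mlen S l) b)) eps)).
  apply: (K_shadow _ hdk); apply: mixture_density (rhoT b); exact: mixture_ciphertext.
have thr st := threshold_itv l st dk.
have W0 : 0 <= W l ek dk (message (mlen S l) true).
  apply: sumr_ge0 => st _; have /andP[h _] := thr st.
  exact: mulr_ge0 (o0 true st) h.
have W1 : W l ek dk (message (mlen S l) false) <= 1.
  rewrite -(o1 false); apply: ler_sum => st _.
  by have /andP[_ h] := thr st; exact: ler_piMr (o0 false st) h.
pose h := 2^-1 - eps; have h0 : 0 < h by rewrite /h; lra.
rewrite -/h.
have c0 x : x <= 1 -> 0 <= (1 - x) / h by move=> hx; apply: divr_ge0 (ltW h0); rewrite subr_ge0.
have c1 x : x <= 1 - h -> 1 <= (1 - x) / h.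
  by move=> hx; rewrite ler_pdivlMr // mul1r; lra.
have A : 1 - delta - (1 - d (message (mlen S l) true)) / h
    <= W l ek dk (message (mlen S l) true).
  case: (ltP (2^-1 + eps) (p (message (mlen S l) true))) => hp; last first.
    have hx : d (message (mlen S l) true) <= 1 - h by rewrite /h; lra.
    by have := c1 _ hx; lra.
  have := c0 _ d1'; have := sh true.
  suff : \sum_(st : (cout (K l)).-tuple bool) o true st *
      fine (T2 (nat_of_bits dk) st (near_event (p (message (mlen S l) true)) eps))
    <= W l ek dk (message (mlen S l) true) by lra.
  by apply: ler_sum => st _; apply: ler_wpM2l (o0 true st) _ _ (near_le_high _ hp).
have Bd : W l ek dk (message (mlen S l) false)
    <= delta + (1 - d (message (mlen S l) false)) / h.
  case: (ltP (p (message (mlen S l) false)) (2^-1 - eps)) => hp; last first.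
    have hx : d (message (mlen S l) false) <= 1 - h by rewrite /h; lra.
    by have := c1 _ hx; lra.
  have := c0 _ d0'; have := sh false.
  suff : W l ek dk (message (mlen S l) false) <= 1 -
    \sum_(st : (cout (K l)).-tuple bool) o false st *
      fine (T2 (nat_of_bits dk) st (near_event (p (message (mlen S l) false)) eps))
     by lra.
  rewrite -(o1 false) -sumrB; apply: ler_sum => st _.
  rewrite -[X in _ <= X - _]mulr1 -mulrBr.
  exact: ler_wpM2l (o0 false st) _ _ (high_le_near _ hp).
by rewrite mulrDl; lra.
Qed.

(** The average of [final_prob_sub] over the keys: the decryption errors average to
    [1 - correct_prob]. *)
Lemma game_gap (l : nat) (nu : R) :
  (forall m : (mlen S l).-tuple bool, 1 - nu <= correct_prob R S l m) ->
  2^-1 * (1 - 2 * delta) - nu / (2^-1 - eps) <=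
  game_prob S t (coin_adversary S (fun l => cout (K l)) K) threshold false l -
  game_prob S t (coin_adversary S (fun l => cout (K l)) K) threshold true l.
Proof.
move=> hc; have hm : (0 < mlen S l)%N by case: hS.
have /andP[eps_gt0 eps_lt] := heps; rewrite game_prob_coin_sub //.
pose h := 2^-1 - eps; have h0 : 0 < h by rewrite /h; lra.
have hb b : 1 - nu <= correct_prob R S l (message (mlen S l) b).
  have /eqP sb := size_message b hm.
  exact: (hc (Tuple sb)).
suff : (1 - 2 * delta) - ((1 - correct_prob R S l (message (mlen S l) true))
     + (1 - correct_prob R S l (message (mlen S l) false))) / h <=
  \sum_(ek : (eklen S l).-tuple bool) \sum_(dk : (dklen S l).-tuple bool)
    key_prob R S l ek dk * (W l ek dk (message (mlen S l) true)
     - W l ek dk (message (mlen S l) false)).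
  (* Each of the two messages contributes an error of at most [nu]; this factor 2 cancels the 1/2 of
     the coin. *)
  have : ((1 - correct_prob R S l (message (mlen S l) true))
     + (1 - correct_prob R S l (message (mlen S l) false))) / h <= (2 * nu) / h.
    rewrite ler_pM2r ?invr_gt0 //.
    by have := hb true; have := hb false; lra.
  by rewrite -mulrA -/h; lra.
have -> : (1 - 2 * delta) - ((1 - correct_prob R S l (message (mlen S l) true))
     + (1 - correct_prob R S l (message (mlen S l) false))) / h =
  \sum_(ek : (eklen S l).-tuple bool) \sum_(dk : (dklen S l).-tuple bool)
    key_prob R S l ek dk * ((1 - 2 * delta)
    - ((1 - decryption_prob R S l ek dk (message (mlen S l) true))
     + (1 - decryption_prob R S l ek dk (message (mlen S l) false))) / h).
  (* The terms that do not depend on the keys, including [1 / h] from each error, are multiplied by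
     the total key probability, which is 1. *)
  transitivity ((1 - 2 * delta - 2 / h)
    * (\sum_(ek : (eklen S l).-tuple bool) \sum_(dk : (dklen S l).-tuple bool)
         key_prob R S l ek dk)
    + h^-1 * correct_prob R S l (message (mlen S l) true)
    + h^-1 * correct_prob R S l (message (mlen S l) false)).
    by rewrite sum_key_prob //; ring.
  rewrite /correct_prob !mulr_sumr -!big_split /=.
  apply: eq_bigr => ek _; rewrite !mulr_sumr -!big_split /=.
  apply: eq_bigr => dk _; rewrite -!/(decryption_prob _ _ _ _ _ _).
  by ring.
apply: ler_sum => ek _; apply: ler_sum => dk _.
by rewrite ler_wpM2l ?key_prob_ge0 // final_prob_sub.
Qed.

End Distinguisher.

(** [eps < 2^-1] keeps [2^-1 - eps] positive, and [delta < 2^-1] keeps [1 - 2 * delta] positive.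
    There is one test per decryption key, whence [dklen] as the argument of [k] for [log M]. *)
Theorem theorem5p11 (R : realType)
    (k : nat -> nat -> nat -> nat -> nat) (T1 : program)
    (T2 : nat -> seq bool -> probability (measurableTypeR R) R)
    (hT : WEST k T1 T2)
    (eps delta : R) (heps : 0 < eps < 2^-1) (hdelta : 0 < delta < 2^-1) :
  ~ exists S : scheme,
      [/\ UTE S,
          correct R S
        & everlasting_secure R S
            (fun l => k (ctlen S l) (dklen S l)
                        (ceil_inv eps) (ceil_log_inv delta))].
Proof.
move=> [S [hS [nu [nu_negl hc]] secure]].
set t := (fun l => _) in secure.
have [_ /(_ _ _ _ (test_family_decryption hS)) [c hT1]] := hT.
have /andP[eps_gt0 eps_lt] := heps; have /andP[delta_gt0 delta_lt] := hdelta.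
have eps1 : 0 < eps < 1 by apply/andP; split; lra.
have delta1 : 0 < delta < 1 by apply/andP; split; lra.
(* The circuits are merely chosen for each [l]; their uniformity is recovered below from the fact
   that [T1] prints each of them. *)
have /choice [K hK] := fun l => hT1 l eps delta eps1 delta1.
have K_wf l : circuit_wf (K l) by have [? []] := hK l.
have K_cin l : cin (K l) = (t l * ctlen S l)%N.
  by have [? [_ _ _ + _]] := hK l; rewrite up_expnK.
have K_shadow l (rho : operator R) (i : nat) :
    is_density (ctlen S l) rho -> (i < 2 ^ dklen S l)%N ->
    1 - delta <= \sum_(st : (cout (K l)).-tuple bool)
    outcome_prob (K l) (copies (ctlen S l) (t l) rho) st *
    fine (T2 i st (near_event
      (accept_prob (decryption_test S l) (2 ^ dklen S l) i rho) eps)).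
  by move=> hr hi; have [? [_ _ _ _ /(_ rho i hr hi)]] := hK l; rewrite up_expnK.
have uK : uniform_family K.
  apply: (uniform_family_shadow (T1 := T1) (c := c) (a := ceil_inv eps)
    (d := ceil_log_inv delta) _ (polytime_ctlen hS) (polytime_dklen hS)).
    exact: (test_family_decryption hS).2.1.
  move=> l; have [s [hr hs _ _ _]] := hK l; exists s.
  by move: hr hs; rewrite up_expnK.
pose A := coin_adversary S (fun l => cout (K l)) K.
have hA : adversary_qpt S t A.
  split; last by split=> // l; split=> //; rewrite K_cin.
  split; first exact: (uniform_family_coin (polytime_mlen hS)).
  move=> l; split=> //=; last by rewrite addn0.
  have hm : (0 < mlen S l)%N by case: hS.
  by rewrite /circuit_wf /= leqnn addn_gt0 hm.
have gap_negl := secure A (threshold T2) hA (threshold_itv T2).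
have [N1 hN1] := nu_negl 1%N; have [N2 hN2] := gap_negl 1%N.
pose h := 2^-1 - eps; have h0 : 0 < h by rewrite /h; lra.
pose g := 2^-1 * (1 - 2 * delta); have g0 : 0 < g by rewrite /g; lra.
(* At exponent 1, negligibility bounds both [nu l] and the gap by [1 / l]. With [game_gap] this
   gives [g < (1 + h^-1) / l], which fails once [l > C]. *)
pose C := (1 + h^-1) / g.
have C0 : 0 < C by rewrite divr_gt0 // addr_gt0 ?ltr01 // invr_gt0.
have [N3 hN3] : exists N, forall l, (N <= l)%N -> C < l%:R.
  exists (Num.bound C) => l hl; apply: lt_le_trans (archi_boundP (ltW C0)) _.
  by rewrite ler_nat.
pose l := maxn N1 (maxn N2 N3).
have {}hN1 := hN1 l (leq_maxl _ _).
have {}hN2 : `| `|game_prob S t A (threshold T2) false l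
    - game_prob S t A (threshold T2) true l| | < (l%:R ^+ 1)^-1.
  by apply: hN2; rewrite /l; lia.
have {}hN3 : C < l%:R by apply: hN3; rewrite /l; lia.
have := game_gap hS heps hdelta K_wf K_cin K_shadow (hc l).
rewrite -/A -/h -/g => gap.
have l0 : 0 < l%:R :> R by exact: lt_trans hN3.
rewrite expr1 in hN1 hN2.
have hnu : nu l / h <= l%:R^-1 / h.
  rewrite ler_pM2r ?invr_gt0 //.
  exact: le_trans (ler_norm _) (ltW hN1).
have hgap : g - l%:R^-1 / h < l%:R^-1.
  apply: le_lt_trans hN2; rewrite normr_id.
  by apply: le_trans (ler_norm _); lra.
have : g < l%:R^-1 * (1 + h^-1) by rewrite mulrDr mulr1; lra.
rewrite mulrC ltr_pdivlMr // => hlt.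
by move: hN3; rewrite /C ltr_pdivrMr // mulrC; lra.
Qed.
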